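(* Let $X$ be a merge-bicategory. The following are equivalent: 1. $X$ admits an $\mathcal{I}$-algebra structure $\alpha: \mathcal{I}X \to X$ where $\alpha$ is a strong morphism; 2. $X$ is 0-representable.
   Context: Merge-bicategories. A regular 2-polygraph $X$ consists of 0-cells, 1-cells $a: x \to y$, and, for all $n,m\ge 1$, 2-cells $p:(a_1,\ldots,a_n)\to(b_1,\ldots,b_m)$ between non-empty composable sequences of 1-cells with the same initial source and the same final target; $\partial_i^-p=a_i$, $\partial_j^+p=b_j$. Greek capitals denote possibly empty composable sequences; commas denote concatenation. A merge-bicategory is a regular 2-polygraph with operations: given $t:(\Gamma)\to(\Delta_1,\Lambda,\Delta_2)$ and $s:(\Gamma_1,\Lambda,\Gamma_2)\to(\Delta)$ with $\Lambda$ non-empty, occupying outputs $j_1,\ldots,j_2$ of $t$ and inputs $i_1,\ldots,i_2$ of $s$, such that ($\Gamma_1$ or $\Delta_1$ is empty) and ($\Gamma_2$ or $\Delta_2$ is empty), a 2-cell $\mathrm{mrg}_{[j_1,j_2]}^{[i_1,i_2]}(t,s):(\Gamma_1,\Gamma,\Gamma_2)\to(\Delta_1,\Delta,\Delta_2)$; whenever the same pasting diagram of three 2-cells (with the same identifications of output with input 1-cells) can be evaluated by two successive merges in two different orders, the results are equal. No units are part of the structure. Morphisms preserve boundaries and merges; they form the category $\mathbf{MrgBiCat}$. A unit on a non-empty sequence $\Gamma$ is a 2-cell $\mathrm{id}_\Gamma:(\Gamma)\to(\Gamma)$ such that merging any 2-cell with it along $\Gamma$, on either side, returns that 2-cell;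 $X$ is unital if every non-empty composable sequence has a unit. $t:(\Gamma)\to(\Delta_1,a,\Delta_2)$, with $a$ its $j$-th output, is universal at $\partial_j^+$ if for all $\Gamma_1,\Gamma_2$ and non-empty $\Delta$ with ($\Gamma_1$ or $\Delta_1$ empty) and ($\Gamma_2$ or $\Delta_2$ empty), every $s:(\Gamma_1,\Gamma,\Gamma_2)\to(\Delta_1,\Delta,\Delta_2)$ is the merge along $a$ of $t$ and a unique $r:(\Gamma_1,a,\Gamma_2)\to(\Delta)$; universality at $\partial_i^-$ is dual (reversing 2-cells). A tensor of $a,b$ is a 2-cell $(a,b)\to(c)$ universal at $\partial_1^+$. A tensor unit on $x$ is $1_x:x\to x$ such that for all $a:x\to y$ there is a 2-cell $(1_x,a)\to(a)$ universal at $\partial_1^+$ and $\partial_2^-$, and for all $b:z\to x$ a 2-cell $(b,1_x)\to(b)$ universal at $\partial_1^+$ and $\partial_1^-$. A 1-cell $e:x\to x'$ is tensor universal if for each $a:x\to y$ there is a 2-cell $(e,u)\to(a)$, and for each $a':x'\to y$ a 2-cell $(e,a')\to(v)$, both universal at $\partial_1^+$ and $\partial_2^-$; and for each $b':z\to x'$ there is a 2-cell $(u',e)\to(b')$, and for each $b:z\to x$ a 2-cell $(b,e)\to(v')$, both universal at $\partial_1^+$ and $\partial_1^-$ (for some $u,v,u',v'$). Pars, par units, par universal 1-cells are the duals (reverse all 2-cells). $X$ is 0-representable if it is unital and every 0-cell has both a tensor unit and a par unit. A morphism is strong if it maps units on 1-cells to units, tensor (par) universal 1-cells to tensor (par) universal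 1-cells, tensors to tensors and pars to pars. The inflate monad $\mathcal{I}$. For a merge-bicategory $X$, $\mathcal{I}X$ is the merge-bicategory generated by the cells of $X$ together with: - for each 0-cell $x$ of $X$, a 1-cell $\epsilon_x:x\to x$ and 2-cells $\epsilon_{\epsilon_x}:(\epsilon_x)\to(\epsilon_x)$, $r_{\epsilon_x}=l_{\epsilon_x}:(\epsilon_x,\epsilon_x)\to(\epsilon_x)$, $r^*_{\epsilon_x}=l^*_{\epsilon_x}:(\epsilon_x)\to(\epsilon_x,\epsilon_x)$; - for each 1-cell $a:x\to y$ of $X$, 2-cells $\epsilon_a:(a)\to(a)$, $l_a:(\epsilon_x,a)\to(a)$, $l_a^*:(a)\to(\epsilon_x,a)$, $r_a:(a,\epsilon_y)\to(a)$, $r_a^*:(a)\to(a,\epsilon_y)$; subject to the equations: - merges of 2-cells of $X$ have their value in $X$; - for all 2-cells $p$ of $\mathcal{I}X$, if $\partial_i^+p=a$ and $\partial_j^-p=b$ then $\mathrm{mrg}_{[i,i]}^{[1,1]}(p,\epsilon_a)=p$ and $\mathrm{mrg}_{[1,1]}^{[j,j]}(\epsilon_b,p)=p$; - for all 1-cells $a$ of $\mathcal{I}X$, $\mathrm{mrg}_{[1,2]}^{[1,2]}(l_a^*,l_a)=\epsilon_a$ and $\mathrm{mrg}_{[1,2]}^{[1,2]}(r_a^*,r_a)=\epsilon_a$; - for all 2-cells $p:(a,\Gamma)\to(b,\Delta)$ of $\mathcal{I}X$, $\mathrm{mrg}_{[1,1]}^{[2,2]}(p,l_b)=\mathrm{mrg}_{[1,1]}^{[1,1]}(l_a,p)$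 and $\mathrm{mrg}_{[2,2]}^{[1,1]}(l_a^*,p)=\mathrm{mrg}_{[1,1]}^{[1,1]}(p,l_b^* )$; - for all 2-cells $p':(\Gamma',a)\to(\Delta',b)$ of $\mathcal{I}X$ with $n$ inputs and $m$ outputs, $\mathrm{mrg}_{[m,m]}^{[1,1]}(p',r_b)=\mathrm{mrg}_{[1,1]}^{[n,n]}(r_a,p')$ and $\mathrm{mrg}_{[1,1]}^{[n,n]}(r_a^*,p')=\mathrm{mrg}_{[m,m]}^{[1,1]}(p',r_b^* )$; - for all 2-cells $p$ of $\mathcal{I}X$ with $\partial_j^-p=a$, $\partial_{j+1}^-p=b$, respectively $\partial_i^+p=a'$, $\partial_{i+1}^+p=b'$: $\mathrm{mrg}_{[1,1]}^{[j,j]}(r_a,p)=\mathrm{mrg}_{[1,1]}^{[j+1,j+1]}(l_b,p)$, respectively $\mathrm{mrg}_{[i,i]}^{[1,1]}(p,r^*_{a'})=\mathrm{mrg}_{[i+1,i+1]}^{[1,1]}(p,l^*_{b'})$. For $f:X\to Y$, $\mathcal{I}f$ acts as $f$ on cells of $X$ and sends $\epsilon_x,\epsilon_a,l_a,l_a^*,r_a,r_a^*$ to $\epsilon_{f(x)},\epsilon_{f(a)},l_{f(a)},l^*_{f(a)},r_{f(a)},r^*_{f(a)}$ (where $f(\epsilon_x):=\epsilon_{f(x)}$). The unit $\eta_X:X\to\mathcal{I}X$ is the inclusion. The multiplication $\mu_X:\mathcal{I}\mathcal{I}X\to\mathcal{I}X$ is the identity on $\eta_{\mathcal{I}X}(\mathcal{I}X)$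 and sends the cells $\tilde\epsilon_x,\tilde\epsilon_a,\tilde l_a,\tilde l_a^*,\tilde r_a,\tilde r_a^*$ added at the second iteration to $\epsilon_x,\epsilon_{\mu_X a},l_{\mu_X a},l^*_{\mu_X a},r_{\mu_X a},r^*_{\mu_X a}$. An $\mathcal{I}$-algebra structure on $X$ is a morphism $\alpha:\mathcal{I}X\to X$ with $\alpha\eta_X=\mathrm{id}_X$ and $\alpha\circ\mathcal{I}\alpha=\alpha\circ\mu_X$. *)

(* Defs.v *)
From mathcomp Require Import all_boot.
From mathcomp Require Import generic_quotient boolp.

Set Implicit Arguments.
Unset Strict Implicit.
Unset Printing Implicit Defensive.

Local Open Scope quotient_scope.

(* The data of a merge-bicategory.  Positions are counted from 0, and a merge
   is given by the two starting positions and the common length of the merged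
   segment: [mrg j i l t s] is mrg_[j+1,j+l]^[i+1,i+l](t,s), the
   outputs j, ..., j+l-1 of t being identified with the inputs i, ..., i+l-1
   of s.  [mrg] is total for convenience; nothing is ever required of its value
   unless [mergeable j i l (outp t) (inp s)]. *)
Record mergeData := MergeData {
  cell0 : Type;
  cell1 : Type;
  src : cell1 -> cell0;
  tgt : cell1 -> cell0;
  cell2 : Type;
  inp : cell2 -> seq cell1;
  outp : cell2 -> seq cell1;
  mrg : nat -> nat -> nat -> cell2 -> cell2 -> cell2 }.

(* With D = D1 ++ L ++ D2, G = G1 ++ L ++ G2, |D1| = j, |G1| = i, |L| = l:
   the segment L is non-empty, G1 or D1 is empty, and G2 or D2 is empty. *)
Definition mergeable (T : Type) (j i l : nat) (D G : seq T) : Prop :=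
  [/\ [/\ 0 < l, j + l <= size D & i + l <= size G],
      take l (drop j D) = take l (drop i G),
      i = 0 \/ j = 0 &
      i + l = size G \/ j + l = size D].

Definition splice (T : Type) (i l : nat) (s r : seq T) : seq T :=
  take i s ++ r ++ drop (i + l) s.

Section Composable.
Variable X : mergeData.

Fixpoint is_path (x : cell0 X) (s : seq (cell1 X)) (y : cell0 X) : Prop :=
  if s is a :: s' then src a = x /\ is_path (tgt a) s' y else x = y.

Definition composable (s : seq (cell1 X)) : Prop :=
  exists x y, is_path x s y.

End Composable.

(* Bracketings of iterated merges of three 2-cells c 0, c 1, c 2. *)
Inductive mtree :=
  | Leaf of 'I_3
  | Node of nat & nat & nat & mtree & mtree.

Fixpoint leaves (T : mtree) : seq 'I_3 :=
  match T with
  | Leaf k => [:: k]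
  | Node _ _ _ T1 T2 => leaves T1 ++ leaves T2
  end.

Section Trees.
Variable X : mergeData.
Variable c : 'I_3 -> cell2 X.

Fixpoint eval (T : mtree) : cell2 X :=
  match T with
  | Leaf k => c k
  | Node j i l T1 T2 => mrg j i l (eval T1) (eval T2)
  end.

Fixpoint evaluable (T : mtree) : Prop :=
  match T with
  | Leaf k => True
  | Node j i l T1 T2 =>
    [/\ evaluable T1, evaluable T2 &
        mergeable j i l (outp (eval T1)) (inp (eval T2))]
  end.

(* The n-th input (or output) of the k-th 2-cell is represented by (k, n). *)
Fixpoint in_ports (T : mtree) : seq ('I_3 * nat) :=
  match T with
  | Leaf k => [seq (k, n) | n <- iota 0 (size (inp (c k)))]
  | Node j i l T1 T2 => splice i l (in_ports T2) (in_ports T1)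
  end.

Fixpoint out_ports (T : mtree) : seq ('I_3 * nat) :=
  match T with
  | Leaf k => [seq (k, n) | n <- iota 0 (size (outp (c k)))]
  | Node j i l T1 T2 => splice j l (out_ports T1) (out_ports T2)
  end.

(* The identifications (output of one 2-cell, input of another one). *)
Fixpoint glued (T : mtree) : seq (('I_3 * nat) * ('I_3 * nat)) :=
  match T with
  | Leaf k => [::]
  | Node j i l T1 T2 =>
    zip (take l (drop j (out_ports T1))) (take l (drop i (in_ports T2)))
      ++ glued T1 ++ glued T2
  end.

Definition ternary (T : mtree) : Prop :=
  perm_eq (leaves T) (enum 'I_3) /\ evaluable T.

(* By planarity the identifications determine the order of the remaining ports;
   the ports are compared as well so that equality of boundaries is immediate. *)
Definition same_diagram (T T' : mtree) : Prop :=
  [/\ glued T =i glued T', in_ports T = in_ports T' &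
      out_ports T = out_ports T'].

End Trees.

Record is_mergeBicat (X : mergeData) : Prop := {
  inp_neq0 : forall p : cell2 X, inp p <> [::];
  outp_neq0 : forall p : cell2 X, outp p <> [::];
  parallel : forall p : cell2 X,
    exists x y, is_path x (inp p) y /\ is_path x (outp p) y;
  inp_mrg : forall j i l (t s : cell2 X), mergeable j i l (outp t) (inp s) ->
    inp (mrg j i l t s) = splice i l (inp s) (inp t);
  outp_mrg : forall j i l (t s : cell2 X), mergeable j i l (outp t) (inp s) ->
    outp (mrg j i l t s) = splice j l (outp t) (outp s);
  mrg_coherent : forall (c : 'I_3 -> cell2 X) (T T' : mtree),
    ternary c T -> ternary c T' -> same_diagram c T T' -> eval c T = eval c T' }.

Record mergeBicat := MergeBicat {
  mdata :> mergeData;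
  maxioms : is_mergeBicat mdata }.

Record is_morphism (X Y : mergeData) (f0 : cell0 X -> cell0 Y)
    (f1 : cell1 X -> cell1 Y) (f2 : cell2 X -> cell2 Y) : Prop := {
  mor_src : forall a, src (f1 a) = f0 (src a);
  mor_tgt : forall a, tgt (f1 a) = f0 (tgt a);
  mor_inp : forall p, inp (f2 p) = map f1 (inp p);
  mor_outp : forall p, outp (f2 p) = map f1 (outp p);
  mor_mrg : forall j i l t s, mergeable j i l (outp t) (inp s) ->
    f2 (mrg j i l t s) = mrg j i l (f2 t) (f2 s) }.

Record morphism (X Y : mergeData) := Morphism {
  mor0 : cell0 X -> cell0 Y;
  mor1 : cell1 X -> cell1 Y;
  mor2 : cell2 X -> cell2 Y;
  moraxioms : is_morphism mor0 mor1 mor2 }.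

Lemma mergeable_map (T U : Type) (f : T -> U) j i l (D G : seq T) :
  mergeable j i l D G -> mergeable j i l (map f D) (map f G).
Proof.
case=> [[h1 h2 h3] e ? ?]; split; rewrite ?size_map //.
by rewrite -!map_drop -!map_take e.
Qed.

Lemma splice_map (T U : Type) (f : T -> U) i l (s r : seq T) :
  map f (splice i l s r) = splice i l (map f s) (map f r).
Proof. by rewrite /splice !map_cat map_take map_drop. Qed.

Lemma id_is_morphism (X : mergeData) :
  @is_morphism X X (fun x => x) (fun a => a) (fun p => p).
Proof. by split=> // *; rewrite map_id. Qed.

Definition id_mor (X : mergeData) : morphism X X :=
  Morphism (id_is_morphism X).

Lemma comp_is_morphism (X Y Z : mergeData) (g : morphism Y Z)
    (f : morphism X Y) :
  is_morphism (mor0 g \o mor0 f) (mor1 g \o mor1 f) (mor2 g \o mor2 f).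
Proof.
case: f g => f0 f1 f2 [h1 h2 h3 h4 h5] [g0 g1 g2 [k1 k2 k3 k4 k5]] /=.
split=> [a|a|p|p|j i l t s m] /=; first by rewrite k1 h1.
- by rewrite k2 h2.
- by rewrite k3 h3 map_comp.
- by rewrite k4 h4 map_comp.
by rewrite h5 // k5 // h3 h4; apply: mergeable_map.
Qed.

Definition comp_mor (X Y Z : mergeData) (g : morphism Y Z) (f : morphism X Y) :
  morphism X Z := Morphism (comp_is_morphism g f).

Lemma morphism_ext (X Y : mergeData) (f g : morphism X Y) :
  mor0 f =1 mor0 g -> mor1 f =1 mor1 g -> mor2 f =1 mor2 g -> f = g.
Proof.
case: f g => [f0 f1 f2 hf] [g0 g1 g2 hg] /= /funext e0 /funext e1 /funext e2.
by subst g0 g1 g2; rewrite (Prop_irrelevance hf hg).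
Qed.

(* Reversal of 2-cells. *)
Definition opd (X : mergeData) : mergeData := {|
  cell0 := cell0 X;
  cell1 := cell1 X;
  src := @src X;
  tgt := @tgt X;
  cell2 := cell2 X;
  inp := @outp X;
  outp := @inp X;
  mrg := fun j i l t s => @mrg X i j l s t |}.

Section Universality.

Definition is_unit (X : mergeData) (G : seq (cell1 X)) (u : cell2 X) : Prop :=
  [/\ inp u = G, outp u = G,
      forall j p, mergeable j 0 (size G) (outp p) (inp u) ->
        mrg j 0 (size G) p u = p &
      forall i p, mergeable 0 i (size G) (outp u) (inp p) ->
        mrg 0 i (size G) u p = p].

Definition unital (X : mergeData) : Prop :=
  forall G : seq (cell1 X), G <> [::] -> composable G -> exists u, is_unit G u.

Definition out_universal (X : mergeData) (t : cell2 X) (j : nat) : Prop :=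
  exists D1 a D2, [/\ outp t = D1 ++ a :: D2, size D1 = j &
    forall (G1 G2 D : seq (cell1 X)) (s : cell2 X),
      D <> [::] ->
      G1 = [::] \/ D1 = [::] ->
      G2 = [::] \/ D2 = [::] ->
      inp s = G1 ++ inp t ++ G2 ->
      outp s = D1 ++ D ++ D2 ->
      exists! r, [/\ inp r = G1 ++ a :: G2, outp r = D &
                     mrg j (size G1) 1 t r = s]].

Definition in_universal (X : mergeData) (t : cell2 X) (i : nat) : Prop :=
  @out_universal (opd X) t i.

Definition is_tensor (X : mergeData) (t : cell2 X) : Prop :=
  exists a b c : cell1 X,
    [/\ inp t = [:: a; b], outp t = [:: c] & out_universal t 0].

(* A 2-cell (e, a) -> (c) universal at its output and at its input a. *)
Definition left_universal (X : mergeData) (e a c : cell1 X) : Prop :=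
  exists t : cell2 X, [/\ inp t = [:: e; a], outp t = [:: c],
                          out_universal t 0 & in_universal t 1].

(* A 2-cell (b, e) -> (c) universal at its output and at its input b. *)
Definition right_universal (X : mergeData) (b e c : cell1 X) : Prop :=
  exists t : cell2 X, [/\ inp t = [:: b; e], outp t = [:: c],
                          out_universal t 0 & in_universal t 0].

Definition is_tensor_unit (X : mergeData) (x : cell0 X) (e : cell1 X) : Prop :=
  [/\ src e = x, tgt e = x,
      forall a : cell1 X, src a = x -> left_universal e a a &
      forall b : cell1 X, tgt b = x -> right_universal b e b].

(* The boundary of the quantified witnesses u, v, u', v' is forced by that of
   the 2-cells. *)
Definition tensor_universal (X : mergeData) (e : cell1 X) : Prop :=
  [/\ forall a : cell1 X, src a = src e -> exists u, left_universal e u a,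
      forall a' : cell1 X, src a' = tgt e -> exists v, left_universal e a' v,
      forall b' : cell1 X, tgt b' = tgt e -> exists u', right_universal u' e b' &
      forall b : cell1 X, tgt b = src e -> exists v', right_universal b e v'].

Definition is_par (X : mergeData) (t : cell2 X) : Prop :=
  @is_tensor (opd X) t.

Definition is_par_unit (X : mergeData) (x : cell0 X) (e : cell1 X) : Prop :=
  @is_tensor_unit (opd X) x e.

Definition par_universal (X : mergeData) (e : cell1 X) : Prop :=
  @tensor_universal (opd X) e.

Definition zero_representable (X : mergeData) : Prop :=
  unital X /\
  forall x : cell0 X,
    (exists e, is_tensor_unit x e) /\ (exists e, is_par_unit x e).

Record strong (X Y : mergeData) (f : morphism X Y) : Prop := {
  strong_unit : forall (a : cell1 X) u,
    is_unit [:: a] u -> is_unit [:: mor1 f a] (mor2 f u);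
  strong_tensor_universal : forall e,
    tensor_universal e -> tensor_universal (mor1 f e);
  strong_par_universal : forall e,
    par_universal e -> par_universal (mor1 f e);
  strong_tensor : forall t, is_tensor t -> is_tensor (mor2 f t);
  strong_par : forall t, is_par t -> is_par (mor2 f t) }.

End Universality.

Lemma is_path_cat (X : mergeData) (s1 s2 : seq (cell1 X)) x y :
  is_path x (s1 ++ s2) y <-> exists z, is_path x s1 z /\ is_path z s2 y.
Proof.
elim: s1 x => [|a s1 IH] x /=.
  by split=> [h|[z [-> h]] //]; exists x.
split=> [[e /IH [z [h1 h2]]]|[z [[e h1] h2]]]; first by exists z.
by split=> //; apply/IH; exists z.
Qed.

Lemma is_path_inj (X : mergeData) (s : seq (cell1 X)) x y x' y' :
  s <> [::] -> is_path x s y -> is_path x' s y' -> x = x' /\ y = y'.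
Proof.
case: s => // a s _ /= [<- h] [<- h']; split=> //.
elim: s (tgt a) h h' => [|b s IH] z /=; first by move=> <- <-.
by move=> [_ h] [_ h']; apply: IH h h'.
Qed.

Lemma mergeableP (T : Type) j i l (D G : seq T) : mergeable j i l D G <->
  exists D1 D2 G1 G2 L, [/\ [/\ D = D1 ++ L ++ D2, G = G1 ++ L ++ G2 & L <> [::]],
    [/\ size D1 = j, size G1 = i & size L = l],
    G1 = [::] \/ D1 = [::] & G2 = [::] \/ D2 = [::]].
Proof.
split.
  case=> [[l0 hj hi] e c1 c2].
  exists (take j D), (drop (j + l) D), (take i G), (drop (i + l) G).
  exists (take l (drop j D)).
  have sj : size (take j D) = j by rewrite size_takel // (leq_trans _ hj) ?leq_addr.
  have si : size (take i G) = i by rewrite size_takel // (leq_trans _ hi) ?leq_addr.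
  have sl : size (take l (drop j D)) = l.
    by rewrite size_takel // size_drop leq_subRL // (leq_trans _ hj) ?leq_addr.
  split.
  - split.
    + by rewrite addnC -drop_drop cat_take_drop cat_take_drop.
    + by rewrite e addnC -drop_drop cat_take_drop cat_take_drop.
    + by move=> e0; move: sl l0; rewrite e0 /= => <-.
  - by [].
  - by case: c1 => ->; rewrite take0; [left|right].
  - by case: c2 => ->; rewrite drop_size; [left|right].
case=> D1 [D2 [G1 [G2 [L [[-> -> L0] [<- <- <-] c1 c2]]]]]; split.
- by rewrite !size_cat !addnA !leq_addr; split=> //; case: L L0.
- by rewrite !drop_size_cat // !take_size_cat.
- by case: c1 => ->; [left|right].
- by case: c2 => ->; rewrite cats0 !size_cat; [left|right].
Qed.

Lemma splice_cat (T : Type) (s1 s s2 r : seq T) :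
  splice (size s1) (size s) (s1 ++ s ++ s2) r = s1 ++ r ++ s2.
Proof.
rewrite /splice take_size_cat // addnC -drop_drop drop_size_cat //.
by rewrite drop_size_cat.
Qed.

Lemma splice_parallel (X : mergeData) j i l (D G D' G' : seq (cell1 X)) :
  mergeable j i l D G ->
  (exists x y, is_path x G' y /\ is_path x D y) ->
  (exists x y, is_path x G y /\ is_path x D' y) ->
  exists x y, is_path x (splice i l G G') y /\ is_path x (splice j l D D') y.
Proof.
case/mergeableP=> D1 [D2 [G1 [G2 [L [[-> -> L0] [<- <- <-] c1 c2]]]]].
case=> x [y [pG' /is_path_cat [u [pD1 /is_path_cat [v [pL pD2]]]]]].
case=> x' [y' [/is_path_cat [u' [pG1 /is_path_cat [v' [pL' pG2]]]] pD']].
rewrite !splice_cat.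
have [eu ev] := is_path_inj L0 pL pL'; subst u' v'.
have [a [qG1 qD1]] : exists a, is_path a G1 x /\ is_path a D1 x'.
  case: c1 => e; subst; move: pG1 pD1 => /=; first by move=> -> ?; exists x.
  by move=> ? ->; exists x'.
have [b [qG2 qD2]] : exists b, is_path y G2 b /\ is_path y' D2 b.
  case: c2 => e; subst; move: pG2 pD2 => /=; first by move=> <- ?; exists y.
  by move=> ? <-; exists y'.
by exists a, b; split; apply/is_path_cat; [exists x|exists x']; split=> //;
  apply/is_path_cat; [exists y|exists y'].
Qed.

Lemma onth_split (T : Type) (s : seq T) n a : onth s n = Some a ->
  exists s1 s2, s = s1 ++ a :: s2 /\ size s1 = n.
Proof.
elim: s n => [|b s IH] [|n] //=; first by case=> <-; exists [::], s.
by move=> /IH [s1 [s2 [-> <-]]]; exists (b :: s1), s2.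
Qed.

Lemma mergeable_out (T : Type) (s : seq T) n a :
  onth s n = Some a -> mergeable n 0 1 s [:: a].
Proof.
move=> h; have [s1 [s2 [-> <-]]] := onth_split h; apply/mergeableP.
by exists s1, s2, [::], [::], [:: a]; split; [split|split|left|left].
Qed.

Lemma mergeable_in (T : Type) (s : seq T) n a :
  onth s n = Some a -> mergeable 0 n 1 [:: a] s.
Proof.
move=> h; have [s1 [s2 [-> <-]]] := onth_split h; apply/mergeableP.
by exists [::], [::], s1, s2, [:: a]; split; [split|split|right|right].
Qed.

Lemma splice_onth (T : Type) (s : seq T) n a r :
  onth s n = Some a -> exists s1 s2,
    [/\ s = s1 ++ a :: s2, size s1 = n & splice n 1 s r = s1 ++ r ++ s2].
Proof.
move=> h; have [s1 [s2 [-> <-]]] := onth_split h; exists s1, s2; split=> //.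
exact: (@splice_cat _ s1 [:: a] s2 r).
Qed.

Lemma splice_rcons (T : Type) (s : seq T) a r :
  splice (size s) 1 (rcons s a) r = s ++ r.
Proof. by rewrite -cats1 (@splice_cat _ s [:: a] [::] r) cats0. Qed.

Lemma mergeable_r (T : Type) (s : seq T) a r :
  mergeable (size s) 0 1 (rcons s a) (a :: r).
Proof.
apply/mergeableP; exists s, [::], [::], r, [:: a]; rewrite cats1.
by split; [split|split|left|right].
Qed.

Lemma mergeable_rs (T : Type) (s : seq T) a r :
  mergeable 0 (size s) 1 (a :: r) (rcons s a).
Proof.
apply/mergeableP; exists [::], r, s, [::], [:: a]; rewrite cats1.
by split; [split|split|right|left].
Qed.

Lemma mergeable_l (T : Type) (s : seq T) a e :
  mergeable 0 1 1 (a :: s) [:: e; a].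
Proof.
apply/mergeableP; exists [::], s, [:: e], [::], [:: a].
by split; [split|split|right|left].
Qed.

Lemma mergeable_ls (T : Type) (s : seq T) a e :
  mergeable 1 0 1 [:: e; a] (a :: s).
Proof.
apply/mergeableP; exists [:: e], [::], [::], s, [:: a].
by split; [split|split|left|right].
Qed.

Lemma adjacent_split (T : Type) (s1 s2 s3 s4 : seq T) a b n :
  s1 ++ a :: s2 = s3 ++ b :: s4 -> size s1 = n -> size s3 = n.+1 ->
  s3 = s1 ++ [:: a] /\ s2 = b :: s4.
Proof.
elim: s1 s3 n => [|c s1 IH] [|d s3] n //=.
  by case: s3 => [|? ?] // -[<- ->] <-.
case=> <- e; case: n => // n [h] [k].
by have [-> ->] := IH _ _ e h k.
Qed.

Section TreeLemmas.
Variable X : mergeData.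
Hypothesis inpM : forall j i l (t s : cell2 X),
  mergeable j i l (outp t) (inp s) ->
  inp (mrg j i l t s) = splice i l (inp s) (inp t).
Hypothesis outpM : forall j i l (t s : cell2 X),
  mergeable j i l (outp t) (inp s) ->
  outp (mrg j i l t s) = splice j l (outp t) (outp s).
Variable c : 'I_3 -> cell2 X.

Let in_label (q : 'I_3 * nat) := onth (inp (c q.1)) q.2.
Let out_label (q : 'I_3 * nat) := onth (outp (c q.1)) q.2.

Lemma map_onth_iota (T : Type) (s : seq T) (k : 'I_3) :
  [seq onth s q.2 | q <- [seq (k, n) | n <- iota 0 (size s)]] = map Some s.
Proof.
rewrite -map_comp; elim: s => //= a s IH; congr (_ :: _).
by rewrite -IH -[in iota 1 _]add1n iotaDl -map_comp.
Qed.

Lemma portsE T : evaluable c T ->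
  map Some (inp (eval c T)) = map in_label (in_ports c T) /\
  map Some (outp (eval c T)) = map out_label (out_ports c T).
Proof.
elim: T => [k _|j i l T1 IH1 T2 IH2] /=.
  rewrite -(map_onth_iota _ k) -(map_onth_iota (outp _) k) -!map_comp.
  by split; apply: eq_map.
case=> /IH1 [e1 f1] /IH2 [e2 f2] m.
by rewrite inpM // outpM // !splice_map e1 e2 f1 f2.
Qed.

Lemma same_diagram_bd T T' : evaluable c T -> evaluable c T' ->
  same_diagram c T T' ->
  inp (eval c T) = inp (eval c T') /\ outp (eval c T) = outp (eval c T').
Proof.
move=> /portsE [e1 f1] /portsE [e2 f2] [_ e f].
have inj : injective (map (@Some (cell1 X))) by apply: inj_map => ? ? [].
by split; apply: inj; [rewrite e1 e2 e|rewrite f1 f2 f].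
Qed.

End TreeLemmas.

(* Ports only depend on the number of inputs and outputs of the leaves. *)
Lemma ports_size (X Y : mergeData) (c : 'I_3 -> cell2 X) (d : 'I_3 -> cell2 Y) :
  (forall k, size (inp (c k)) = size (inp (d k))) ->
  (forall k, size (outp (c k)) = size (outp (d k))) ->
  forall T, [/\ in_ports c T = in_ports d T, out_ports c T = out_ports d T &
                glued c T = glued d T].
Proof.
move=> e f; elim=> [k|j i l T1 [h1 h2 h3] T2 [k1 k2 k3]] /=.
  by rewrite e f.
by rewrite h1 h2 h3 k1 k2 k3.
Qed.

Lemma same_diagram_size (X Y : mergeData) (c : 'I_3 -> cell2 X)
    (d : 'I_3 -> cell2 Y) T T' :
  (forall k, size (inp (c k)) = size (inp (d k))) ->
  (forall k, size (outp (c k)) = size (outp (d k))) ->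
  same_diagram c T T' -> same_diagram d T T'.
Proof.
move=> e f; have [h1 h2 h3] := ports_size e f T.
by have [k1 k2 k3] := ports_size e f T'; rewrite /same_diagram h1 h2 h3 k1 k2 k3.
Qed.

Section Inflate.
Variable X : mergeBicat.

(* [iunit x] is the 1-cell eps_x. *)
Inductive icell1 :=
  | iold of cell1 X
  | iunit of cell0 X.

Definition isrc (a : icell1) : cell0 X :=
  match a with iold a => src a | iunit x => x end.

Definition itgt (a : icell1) : cell0 X :=
  match a with iold a => tgt a | iunit x => x end.

(* Formal merges of generators: [teps a], [tl a], [tls a], [tr a], [trs a]
   stand for eps_a, l_a, l_a^*, r_a, r_a^*. *)
Inductive iterm :=
  | tcell of cell2 X
  | teps of icell1
  | tl of icell1
  | tls of icell1
  | tr of icell1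
  | trs of icell1
  | tmrg of nat & nat & nat & iterm & iterm.

Fixpoint tinp (t : iterm) : seq icell1 :=
  match t with
  | tcell p => map iold (inp p)
  | teps a => [:: a]
  | tl a => [:: iunit (isrc a); a]
  | tls a => [:: a]
  | tr a => [:: a; iunit (itgt a)]
  | trs a => [:: a]
  | tmrg j i l t s => splice i l (tinp s) (tinp t)
  end.

Fixpoint toutp (t : iterm) : seq icell1 :=
  match t with
  | tcell p => map iold (outp p)
  | teps a => [:: a]
  | tl a => [:: a]
  | tls a => [:: iunit (isrc a); a]
  | tr a => [:: a]
  | trs a => [:: a; iunit (itgt a)]
  | tmrg j i l t s => splice j l (toutp t) (toutp s)
  end.

Fixpoint twf (t : iterm) : Prop :=
  match t with
  | tmrg j i l t s => [/\ twf t, twf s & mergeable j i l (toutp t) (tinp s)]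
  | _ => True
  end.

Definition tdata : mergeData := {|
  src := isrc;
  tgt := itgt;
  inp := tinp;
  outp := toutp;
  mrg := tmrg |}.

(* Besides the equations of a merge-bicategory ([tc_coherent]) and the defining
   equations of the inflation, [tc_lr] and [tc_lsrs] identify the two names of
   the generators r_(eps_x) = l_(eps_x) and r^*_(eps_x) = l^*_(eps_x). *)
Inductive tcong : iterm -> iterm -> Prop :=
  | tc_refl t : tcong t t
  | tc_sym t u : tcong t u -> tcong u t
  | tc_trans t u v : tcong t u -> tcong u v -> tcong t v
  | tc_mrg j i l t t' s s' :
      twf (tmrg j i l t s) -> tcong t t' -> tcong s s' ->
      tcong (tmrg j i l t s) (tmrg j i l t' s')
  | tc_coherent (c : 'I_3 -> cell2 tdata) (T T' : mtree) :
      (forall k, twf (c k)) ->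
      ternary c T -> ternary c T' -> same_diagram c T T' ->
      tcong (eval c T) (eval c T')
  | tc_lr x : tcong (tl (iunit x)) (tr (iunit x))
  | tc_lsrs x : tcong (tls (iunit x)) (trs (iunit x))
  | tc_cell j i l (p q : cell2 X) : mergeable j i l (outp p) (inp q) ->
      tcong (tmrg j i l (tcell p) (tcell q)) (tcell (mrg j i l p q))
  | tc_eps_outp p i a : twf p -> onth (toutp p) i = Some a ->
      tcong (tmrg i 0 1 p (teps a)) p
  | tc_eps_inp p j b : twf p -> onth (tinp p) j = Some b ->
      tcong (tmrg 0 j 1 (teps b) p) p
  | tc_lsl a : tcong (tmrg 0 0 2 (tls a) (tl a)) (teps a)
  | tc_rsr a : tcong (tmrg 0 0 2 (trs a) (tr a)) (teps a)
  | tc_l_nat p a G b D : twf p -> tinp p = a :: G -> toutp p = b :: D ->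
      tcong (tmrg 0 1 1 p (tl b)) (tmrg 0 0 1 (tl a) p)
  | tc_ls_nat p a G b D : twf p -> tinp p = a :: G -> toutp p = b :: D ->
      tcong (tmrg 1 0 1 (tls a) p) (tmrg 0 0 1 p (tls b))
  | tc_r_nat p a G b D : twf p -> tinp p = rcons G a -> toutp p = rcons D b ->
      tcong (tmrg (size D) 0 1 p (tr b)) (tmrg 0 (size G) 1 (tr a) p)
  | tc_rs_nat p a G b D : twf p -> tinp p = rcons G a -> toutp p = rcons D b ->
      tcong (tmrg 0 (size G) 1 (trs a) p) (tmrg (size D) 0 1 p (trs b))
  | tc_rl p j a b : twf p ->
      onth (tinp p) j = Some a -> onth (tinp p) j.+1 = Some b ->
      tcong (tmrg 0 j 1 (tr a) p) (tmrg 0 j.+1 1 (tl b) p)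
  | tc_rsls p i a b : twf p ->
      onth (toutp p) i = Some a -> onth (toutp p) i.+1 = Some b ->
      tcong (tmrg i 0 1 p (trs a)) (tmrg i.+1 0 1 p (tls b)).

Lemma twf_parallel t : twf t ->
  exists x y, @is_path tdata x (tinp t) y /\ @is_path tdata x (toutp t) y.
Proof.
elim: t => [p _|a _|a _|a _|a _|a _|j i l t IHt s IHs [wt ws m]].
- have [x [y [h k]]] := parallel (maxioms X) p.
  have mp s : forall z, @is_path X z s y -> @is_path tdata z (map iold s) y.
    by elim: s => //= b s IH z [e /IH].
  by exists x, y; split; apply: mp.
- by exists (isrc a), (itgt a).
- by exists (isrc a), (itgt a).
- by exists (isrc a), (itgt a).
- by exists (isrc a), (itgt a).
- by exists (isrc a), (itgt a).
exact: (@splice_parallel tdata _ _ _ _ _ _ _ m (IHt wt) (IHs ws)).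
Qed.

Lemma twf_neq0 t : twf t -> tinp t <> [::] /\ toutp t <> [::].
Proof.
elim: t => // [p _|j i l t IHt s IHs [wt ws m]] /=.
  have := @inp_neq0 _ (maxioms X) p; have := @outp_neq0 _ (maxioms X) p.
  by case: (inp p) (outp p) => [|? ?] [].
have [[h1 _] [_ h2]] := (IHt wt, IHs ws).
rewrite /splice; split; first by case: (take _ _) (tinp t) h1 => [|? ?] [].
by case: (take _ _) (toutp s) h2 => [|? ?] [].
Qed.

Lemma twf_eval (c : 'I_3 -> cell2 tdata) T : (forall k, twf (c k)) ->
  evaluable c T -> twf (eval c T).
Proof.
by move=> w; elim: T => //= j i l T1 IH1 T2 IH2 [/IH1 ? /IH2 ? ?].
Qed.

Lemma iold_inj : injective iold. Proof. by move=> a b []. Qed.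

Lemma mergeable_map_inj (T U : Type) (f : T -> U) j i l (D G : seq T) :
  injective f -> mergeable j i l (map f D) (map f G) -> mergeable j i l D G.
Proof.
move=> fi [[h1 h2 h3] e h4 h5]; move: h2 h3 h4 h5.
rewrite !size_map => h2 h3 h4 h5; split=> //; apply: (inj_map fi).
by rewrite !map_take !map_drop.
Qed.

Let same_bd (t u : iterm) :=
  [/\ twf t <-> twf u, tinp t = tinp u & toutp t = toutp u].

Let wf_bd t u : twf t -> twf u -> tinp t = tinp u -> toutp t = toutp u ->
  same_bd t u.
Proof. by []. Qed.

Lemma tail_path (x y : cell0 X) a s : @is_path tdata x (rcons s a) y ->
  itgt a = y.
Proof. by elim: s x => [|b s IH] x /= [_] // /IH. Qed.

Lemma twf_src p a G b D : twf p -> tinp p = a :: G -> toutp p = b :: D ->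
  isrc a = isrc b.
Proof.
move=> w e f; have [x [y]] := twf_parallel w; rewrite e f.
by case=> -[h _] [k _]; exact: etrans h (esym k).
Qed.

Lemma twf_tgt p a G b D : twf p -> tinp p = rcons G a ->
  toutp p = rcons D b -> itgt a = itgt b.
Proof.
move=> w e f; have [x [y]] := twf_parallel w; rewrite e f.
by case=> /tail_path -> /tail_path ->.
Qed.

Lemma path_mid (x y : cell0 X) s n a b : @is_path tdata x s y ->
  onth s n = Some a -> onth s n.+1 = Some b -> itgt a = isrc b.
Proof.
elim: s n x => [|c s IH] [|n] x //= [_ h]; last exact: IH h.
by case: s h {IH} => //= d s [h _] [<-] [<-].
Qed.

Lemma tcong_bd t u : tcong t u ->
  [/\ twf t <-> twf u, tinp t = tinp u & toutp t = toutp u].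
Proof.
elim=> {t u}.
- by [].
- by move=> t u _ [h -> ->]; split=> //; split; case: h.
- by move=> t u v _ [h -> ->] _ [h' -> ->]; split=> //; case: h h'; tauto.
- by move=> j i l t t' s s' w _ [h1 h2 h3] _ [k1 k2 k3] /=;
    rewrite h2 h3 k2 k3; split=> //; case: w => ? ? ?; split=> -[? ? ?];
    split; tauto.
- move=> c T T' w [_ e] [_ e'] d.
  have [b1 b2] : tinp (eval c T) = tinp (eval c T') /\
                 toutp (eval c T) = toutp (eval c T').
    exact: (@same_diagram_bd tdata).
  by apply: wf_bd => //; apply: twf_eval.
- by [].
- by [].
- move=> j i l p q m; apply: wf_bd => //=.
  + by split=> //; apply: mergeable_map.
  + by rewrite (inp_mrg (maxioms X)) // splice_map.
  + by rewrite (outp_mrg (maxioms X)) // splice_map.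
- move=> p i a w h; apply: wf_bd => //=.
  + by split=> //; apply: mergeable_out.
  + by rewrite /splice cats0.
  + by have [s1 [s2 [e _ ->]]] := splice_onth [:: a] h; rewrite e.
- move=> p i a w h; apply: wf_bd => //=.
  + by split=> //; apply: mergeable_in.
  + by have [s1 [s2 [e _ ->]]] := splice_onth [:: a] h; rewrite e.
  + by rewrite /splice cats0.
- by move=> a; apply: wf_bd => //=; do 2!split=> //; (left + right).
- by move=> a; apply: wf_bd => //=; do 2!split=> //; (left + right).
- move=> p a G b D w e f; apply: wf_bd => //=; rewrite ?e ?f //=.
  + by split=> //; apply: mergeable_l.
  + by split=> //; apply: (@mergeable_in _ _ 0 a).
  + by rewrite /splice /= ?(drop0, cats0) (twf_src w e f).
  + by rewrite /splice /= !(drop0, cats0).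
- move=> p a G b D w e f; apply: wf_bd => //=; rewrite ?e ?f //=.
  + by split=> //; apply: mergeable_ls.
  + by split=> //; apply: (@mergeable_out _ _ 0 b).
  + by rewrite /splice /= !(drop0, cats0).
  + by rewrite /splice /= ?(drop0, cats0) (twf_src w e f).
- move=> p a G b D w e f; apply: wf_bd => //=; rewrite ?e ?f ?splice_rcons //=.
  + by split=> //; apply: mergeable_r.
  + by split=> //; apply: mergeable_rs.
  + by rewrite /splice /= ?(drop0, cats0) (twf_tgt w e f) -cats1 -catA.
  + by rewrite /splice /= cats0 cats1.
- move=> p a G b D w e f; apply: wf_bd => //=; rewrite ?e ?f ?splice_rcons //=.
  + by split=> //; apply: mergeable_rs.
  + by split=> //; apply: mergeable_r.
  + by rewrite /splice /= cats0 cats1.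
  + by rewrite /splice /= ?(drop0, cats0) (twf_tgt w e f) -cats1 -catA.
- move=> p j a b w e f; have [x [y [h _]]] := twf_parallel w.
  have c := path_mid h e f; apply: wf_bd => //=.
  + by split=> //; apply: mergeable_in.
  + by split=> //; apply: mergeable_in.
  + have [s1 [s2 [E E1 ->]]] := splice_onth [:: a; iunit (itgt a)] e.
    have [s3 [s4 [F F1 ->]]] := splice_onth [:: iunit (isrc b); b] f.
    have [-> ->] := adjacent_split (etrans (esym E) F) E1 F1.
    by rewrite -catA /= c.
- move=> p i a b w e f; have [x [y [_ h]]] := twf_parallel w.
  have c := path_mid h e f; apply: wf_bd => //=.
  + by split=> //; apply: mergeable_out.
  + by split=> //; apply: mergeable_out.
  + have [s1 [s2 [E E1 ->]]] := splice_onth [:: a; iunit (itgt a)] e.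
    have [s3 [s4 [F F1 ->]]] := splice_onth [:: iunit (isrc b); b] f.
    have [-> ->] := adjacent_split (etrans (esym E) F) E1 F1.
    by rewrite -catA /= c.
Qed.

Lemma tcong_twf t u : tcong t u -> twf t -> twf u.
Proof. by case/tcong_bd => -[]. Qed.

(* 2-cells of the inflation: well-formed terms up to congruence. *)
Definition wterm := {classic {t : iterm | twf t}}.

Definition wcong (t u : wterm) : bool := `[< tcong (sval t) (sval u) >].

Lemma wcong_refl : reflexive wcong.
Proof. by move=> t; apply/asboolP; apply: tc_refl. Qed.

Lemma wcong_sym : symmetric wcong.
Proof. by move=> t u; apply/asboolP/asboolP; apply: tc_sym. Qed.

Lemma wcong_trans : transitive wcong.
Proof. by move=> u t v /asboolP h /asboolP k; apply/asboolP/(tc_trans h k). Qed.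

Definition wcong_equiv := EquivRel wcong wcong_refl wcong_sym wcong_trans.

Definition icell2 : Type := {eq_quot wcong_equiv}.

Definition icls (t : iterm) (w : twf t) : icell2 :=
  \pi_{eq_quot wcong_equiv} (exist _ t w : wterm).

Definition irepr (p : icell2) : iterm :=
  sval (repr (p : {eq_quot wcong_equiv}) : wterm).

Lemma irepr_wf p : twf (irepr p).
Proof. exact: (svalP (repr (p : {eq_quot wcong_equiv}) : wterm)). Qed.

Lemma irepr_cong t (w : twf t) : tcong (irepr (icls w)) t.
Proof.
apply/asboolP; have /eqquotP := reprK (icls w : {eq_quot wcong_equiv}).
by [].
Qed.

Lemma icls_eq t u (wt : twf t) (wu : twf u) : tcong t u -> icls wt = icls wu.
Proof. by move=> h; apply/eqquotP/asboolP. Qed.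

Lemma ireprK p (w : twf (irepr p)) : icls w = p.
Proof.
rewrite -[RHS](reprK (p : {eq_quot wcong_equiv})); apply/eqquotP/asboolP.
exact: tc_refl.
Qed.

Definition iinp (p : icell2) : seq icell1 := tinp (irepr p).

Definition ioutp (p : icell2) : seq icell1 := toutp (irepr p).

Definition imrg (j i l : nat) (t s : icell2) : icell2 :=
  match pselect (mergeable j i l (ioutp t) (iinp s)) with
  | left m => @icls (tmrg j i l (irepr t) (irepr s))
                    (And3 (irepr_wf t) (irepr_wf s) m)
  | right _ => t
  end.

Definition idata : mergeData := {|
  src := isrc;
  tgt := itgt;
  inp := iinp;
  outp := ioutp;
  mrg := imrg |}.

Lemma iinp_cls t (w : twf t) : iinp (icls w) = tinp t.
Proof. by have [_ h _] := tcong_bd (irepr_cong w). Qed.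

Lemma ioutp_cls t (w : twf t) : ioutp (icls w) = toutp t.
Proof. by have [_ _ h] := tcong_bd (irepr_cong w). Qed.

Lemma imrg_cls j i l t s (wt : twf t) (ws : twf s) (w : twf (tmrg j i l t s)) :
  imrg j i l (icls wt) (icls ws) = icls w.
Proof.
rewrite /imrg; case: pselect => [m|[]]; last first.
  by rewrite iinp_cls ioutp_cls; case: w.
by apply: icls_eq; apply: tc_sym; apply: tc_mrg => //; apply: tc_sym;
  apply: irepr_cong.
Qed.

Lemma eval_icls (c : 'I_3 -> cell2 idata) T : evaluable c T ->
  evaluable (fun k => irepr (c k) : cell2 tdata) T /\
  forall w : twf (eval (fun k => irepr (c k) : cell2 tdata) T),
    eval c T = icls w.
Proof.
pose d k : cell2 tdata := irepr (c k).
have wd k : twf (d k) by apply: irepr_wf.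
elim: T => [k _|j i l T1 IH1 T2 IH2] /=.
  by split=> // w; rewrite ireprK.
case=> /IH1 [v1 e1] /IH2 [v2 e2].
have w1 := twf_eval wd v1; have w2 := twf_eval wd v2.
rewrite (e1 w1) (e2 w2) iinp_cls ioutp_cls => m; split=> // w.
exact: imrg_cls.
Qed.

Lemma inflate_axioms : is_mergeBicat idata.
Proof.
split=> /=.
- by move=> p; have [] := twf_neq0 (irepr_wf p).
- by move=> p; have [] := twf_neq0 (irepr_wf p).
- by move=> p; have [x [y h]] := twf_parallel (irepr_wf p); exists x, y.
- by move=> j i l t s m; rewrite /imrg; case: pselect => // m'; rewrite iinp_cls.
- by move=> j i l t s m; rewrite /imrg; case: pselect => // m'; rewrite ioutp_cls.
move=> c T T' [p v] [p' v'] D.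
pose d k : cell2 tdata := irepr (c k).
have wd k : twf (d k) by apply: irepr_wf.
have [u e] := eval_icls v; have [u' e'] := eval_icls v'.
rewrite (e (twf_eval wd u)) (e' (twf_eval wd u')); apply: icls_eq.
by apply: (tc_coherent wd) => //; apply: same_diagram_size D.
Qed.

Definition inflate : mergeBicat := MergeBicat inflate_axioms.

Definition ieps (a : icell1) : cell2 inflate := @icls (teps a) I.
Definition il (a : icell1) : cell2 inflate := @icls (tl a) I.
Definition ils (a : icell1) : cell2 inflate := @icls (tls a) I.
Definition ir (a : icell1) : cell2 inflate := @icls (tr a) I.
Definition irs (a : icell1) : cell2 inflate := @icls (trs a) I.

Lemma eta_is_morphism : @is_morphism X inflate (fun x => x) iold
  (fun p => @icls (tcell p) I).
Proof.
split=> //= [p|p|j i l t s m]; first exact: iinp_cls.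
  exact: ioutp_cls.
have w : twf (tmrg j i l (tcell t) (tcell s)).
  by split=> //; apply: mergeable_map.
by rewrite (imrg_cls _ _ w); apply: icls_eq; apply: tc_sym; apply: tc_cell.
Qed.

Definition eta : morphism X inflate := Morphism eta_is_morphism.

Section Laws.
Variable p : cell2 inflate.
Let w : twf (irepr p) := irepr_wf p.

Let imrg_gen j i l u (wu : twf u) :
  mergeable j i l (outp p) (tinp u) ->
  exists h : twf (tmrg j i l (irepr p) u),
    mrg j i l p (icls wu : cell2 inflate) = icls h.
Proof.
move=> m; exists (And3 w wu m).
by rewrite -[X in @mrg _ _ _ _ X _](ireprK w); apply: imrg_cls.
Qed.

Let igen_mrg j i l u (wu : twf u) :
  mergeable j i l (toutp u) (inp p) ->
  exists h : twf (tmrg j i l u (irepr p)),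
    mrg j i l (icls wu : cell2 inflate) p = icls h.
Proof.
move=> m; exists (And3 wu w m).
by rewrite -[X in @mrg _ _ _ _ _ X](ireprK w); apply: imrg_cls.
Qed.

Lemma ieps_outp i a : onth (outp p) i = Some a -> mrg i 0 1 p (ieps a) = p.
Proof.
move=> h; have [v ->] := imrg_gen (u := teps a) I (mergeable_out h).
by rewrite -[RHS](ireprK w); apply: icls_eq; apply: tc_eps_outp.
Qed.

Lemma ieps_inp j a : onth (inp p) j = Some a -> mrg 0 j 1 (ieps a) p = p.
Proof.
move=> h; have [v ->] := igen_mrg (u := teps a) I (mergeable_in h).
by rewrite -[RHS](ireprK w); apply: icls_eq; apply: tc_eps_inp.
Qed.

Lemma il_nat a G b D : inp p = a :: G -> outp p = b :: D ->
  mrg 0 1 1 p (il b) = mrg 0 0 1 (il a) p.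
Proof.
move=> e f.
have [|v ->] := imrg_gen (j := 0) (i := 1) (l := 1) (u := tl b) I.
  by rewrite f; apply: mergeable_l.
have [|v' ->] := igen_mrg (j := 0) (i := 0) (l := 1) (u := tl a) I.
  by rewrite e; apply: (@mergeable_in _ _ 0 a).
by apply: icls_eq; apply: tc_l_nat e f.
Qed.

Lemma ils_nat a G b D : inp p = a :: G -> outp p = b :: D ->
  mrg 1 0 1 (ils a) p = mrg 0 0 1 p (ils b).
Proof.
move=> e f.
have [|v ->] := imrg_gen (j := 0) (i := 0) (l := 1) (u := tls b) I.
  by rewrite f; apply: (@mergeable_out _ _ 0 b).
have [|v' ->] := igen_mrg (j := 1) (i := 0) (l := 1) (u := tls a) I.
  by rewrite e; apply: mergeable_ls.
by apply: icls_eq; apply: tc_ls_nat e f.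
Qed.

Lemma ir_nat a G b D : inp p = rcons G a -> outp p = rcons D b ->
  mrg (size D) 0 1 p (ir b) = mrg 0 (size G) 1 (ir a) p.
Proof.
move=> e f.
have [|v ->] := imrg_gen (j := size D) (i := 0) (l := 1) (u := tr b) I.
  by rewrite f; apply: mergeable_r.
have [|v' ->] := igen_mrg (j := 0) (i := size G) (l := 1) (u := tr a) I.
  by rewrite e; apply: mergeable_rs.
by apply: icls_eq; apply: tc_r_nat e f.
Qed.

Lemma irs_nat a G b D : inp p = rcons G a -> outp p = rcons D b ->
  mrg 0 (size G) 1 (irs a) p = mrg (size D) 0 1 p (irs b).
Proof.
move=> e f.
have [|v ->] := imrg_gen (j := size D) (i := 0) (l := 1) (u := trs b) I.
  by rewrite f; apply: mergeable_r.
have [|v' ->] := igen_mrg (j := 0) (i := size G) (l := 1) (u := trs a) I.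
  by rewrite e; apply: mergeable_rs.
by apply: icls_eq; apply: tc_rs_nat e f.
Qed.

Lemma ir_il j a b : onth (inp p) j = Some a -> onth (inp p) j.+1 = Some b ->
  mrg 0 j 1 (ir a) p = mrg 0 j.+1 1 (il b) p.
Proof.
move=> e f; have [v ->] := igen_mrg (u := tr a) I (mergeable_in e).
have [v' ->] := igen_mrg (u := tl b) I (mergeable_in f).
by apply: icls_eq; apply: tc_rl.
Qed.

Lemma irs_ils i a b : onth (outp p) i = Some a -> onth (outp p) i.+1 = Some b ->
  mrg i 0 1 p (irs a) = mrg i.+1 0 1 p (ils b).
Proof.
move=> e f; have [v ->] := imrg_gen (u := trs a) I (mergeable_out e).
have [v' ->] := imrg_gen (u := tls b) I (mergeable_out f).
by apply: icls_eq; apply: tc_rsls.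
Qed.

End Laws.

Lemma il_ir x : il (iunit x) = ir (iunit x).
Proof. by apply: icls_eq; apply: tc_lr. Qed.

Lemma ils_irs x : ils (iunit x) = irs (iunit x).
Proof. by apply: icls_eq; apply: tc_lsrs. Qed.

Lemma mergeable_all (T : Type) (a b : T) :
  mergeable 0 0 2 [:: a; b] [:: a; b].
Proof. by split=> //; left. Qed.

Lemma ils_il a : mrg 0 0 2 (ils a) (il a) = ieps a.
Proof.
have h : twf (tmrg 0 0 2 (tls a) (tl a)) by split=> //; apply: mergeable_all.
by rewrite /= (imrg_cls _ _ h); apply: icls_eq; apply: tc_lsl.
Qed.

Lemma irs_ir a : mrg 0 0 2 (irs a) (ir a) = ieps a.
Proof.
have h : twf (tmrg 0 0 2 (trs a) (tr a)) by split=> //; apply: mergeable_all.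
by rewrite /= (imrg_cls _ _ h); apply: icls_eq; apply: tc_rsr.
Qed.

End Inflate.

(* The morphism inflate X -> inflate Z that extends f : X -> inflate Z and
   preserves the added cells. *)
Section Extension.
Variables X Z : mergeBicat.
Variable f : morphism X (inflate Z).

Definition ext1 (a : icell1 X) : icell1 Z :=
  match a with iold a => mor1 f a | iunit x => @iunit Z (mor0 f x) end.

Fixpoint ext_term (t : iterm X) : cell2 (inflate Z) :=
  match t with
  | tcell p => mor2 f p
  | teps a => ieps (ext1 a)
  | tl a => il (ext1 a)
  | tls a => ils (ext1 a)
  | tr a => ir (ext1 a)
  | trs a => irs (ext1 a)
  | tmrg j i l t s => mrg j i l (ext_term t) (ext_term s)
  end.

Lemma ext1_src a : isrc (ext1 a) = mor0 f (isrc a).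
Proof. by case: a => //= a; apply: (mor_src (moraxioms f)). Qed.

Lemma ext1_tgt a : itgt (ext1 a) = mor0 f (itgt a).
Proof. by case: a => //= a; apply: (mor_tgt (moraxioms f)). Qed.

Lemma ext_bd t : twf t -> inp (ext_term t) = map ext1 (tinp t) /\
  outp (ext_term t) = map ext1 (toutp t).
Proof.
elim: t => [p _|a _|a _|a _|a _|a _|j i l t IHt s IHs [wt ws m]].
- rewrite [LHS](mor_inp (moraxioms f)) [X in _ /\ X = _](mor_outp (moraxioms f)).
  by rewrite /= -!map_comp.
- by rewrite /= iinp_cls ioutp_cls.
- by rewrite /= iinp_cls ioutp_cls /= ext1_src.
- by rewrite /= iinp_cls ioutp_cls /= ext1_src.
- by rewrite /= iinp_cls ioutp_cls /= ext1_tgt.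
- by rewrite /= iinp_cls ioutp_cls /= ext1_tgt.
have [e1 f1] := IHt wt; have [e2 f2] := IHs ws.
have m' : mergeable j i l (outp (ext_term t)) (inp (ext_term s)).
  by rewrite f1 e2; apply: mergeable_map.
have -> : ext_term (tmrg j i l t s) = mrg j i l (ext_term t) (ext_term s) by [].
rewrite (inp_mrg (maxioms (inflate Z)) m') (outp_mrg (maxioms (inflate Z)) m').
by rewrite e1 e2 f1 f2 /= !splice_map.
Qed.

Lemma ext_eval (c : 'I_3 -> cell2 (tdata X)) T : (forall k, twf (c k)) ->
  evaluable c T ->
  evaluable (fun k => ext_term (c k)) T /\
  ext_term (eval c T) = eval (fun k => ext_term (c k)) T.
Proof.
move=> w; elim: T => //= j i l T1 IH1 T2 IH2 [v1 v2 m].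
have [u1 e1] := IH1 v1; have [u2 e2] := IH2 v2.
rewrite -e1 -e2; split=> //; split=> //.
change (mergeable j i l (outp (ext_term (eval c T1)))
                        (inp (ext_term (eval c T2)))).
have [_ ->] := ext_bd (twf_eval w v1); have [-> _] := ext_bd (twf_eval w v2).
exact: mergeable_map.
Qed.

Lemma onth_ext s i a : onth s i = Some a ->
  onth (map ext1 s) i = Some (ext1 a).
Proof. by elim: s i => [|b s IH] [|i] //= => [[->]|/IH]. Qed.

Lemma ext_cong t u : tcong t u -> twf t -> ext_term t = ext_term u.
Proof.
elim=> {t u}.
- by [].
- by move=> t u h IH w; rewrite IH //; apply: tcong_twf (tc_sym h) w.
- by move=> t u v h IH _ IH' w; rewrite IH // IH' //; apply: tcong_twf h w.
- by move=> j i l t t' s s' [wt ws _] _ IHt _ IHs _ /=; rewrite IHt // IHs.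
- move=> c T T' w [p v] [p' v'] d _.
  have [u ->] := ext_eval w v; have [u' ->] := ext_eval w v'.
  apply: (mrg_coherent (maxioms (inflate Z))) => //.
  apply: same_diagram_size d => k; have [h1 h2] := ext_bd (w k).
    by rewrite h1 size_map.
  by rewrite h2 size_map.
- by move=> x _; apply: il_ir.
- by move=> x _; apply: ils_irs.
- by move=> j i l p q m _; rewrite [RHS](mor_mrg (moraxioms f)).
- move=> p i a w h _; apply: ieps_outp.
  by have [_ ->] := ext_bd w; apply: onth_ext.
- move=> p i a w h _; apply: ieps_inp.
  by have [-> _] := ext_bd w; apply: onth_ext.
- by move=> a _; apply: ils_il.
- by move=> a _; apply: irs_ir.
- move=> p a G b D w e g _; have [h1 h2] := ext_bd w.
  by apply: (@il_nat _ _ _ (map ext1 G) _ (map ext1 D)); rewrite ?h1 ?h2 ?e ?g.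
- move=> p a G b D w e g _; have [h1 h2] := ext_bd w.
  by apply: (@ils_nat _ _ _ (map ext1 G) _ (map ext1 D)); rewrite ?h1 ?h2 ?e ?g.
- move=> p a G b D w e g _; have [h1 h2] := ext_bd w.
  rewrite -(size_map ext1 G) -(size_map ext1 D).
  by apply: ir_nat; rewrite ?h1 ?h2 ?e ?g map_rcons.
- move=> p a G b D w e g _; have [h1 h2] := ext_bd w.
  rewrite -(size_map ext1 G) -(size_map ext1 D).
  by apply: irs_nat; rewrite ?h1 ?h2 ?e ?g map_rcons.
- move=> p j a b w e g _; have [h1 _] := ext_bd w.
  by apply: ir_il; rewrite h1; apply: onth_ext.
- move=> p i a b w e g _; have [_ h2] := ext_bd w.
  by apply: irs_ils; rewrite h2; apply: onth_ext.
Qed.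

Lemma ext_is_morphism : @is_morphism (inflate X) (inflate Z) (mor0 f) ext1
  (fun p => ext_term (irepr p)).
Proof.
split=> [a|a|p|p|j i l t s m].
- exact: ext1_src.
- exact: ext1_tgt.
- by have [] := ext_bd (irepr_wf p).
- by have [] := ext_bd (irepr_wf p).
pose w := And3 (irepr_wf t) (irepr_wf s) m.
have -> : mrg j i l t s = @icls _ (tmrg j i l (irepr t) (irepr s)) w.
  rewrite -[X in @mrg _ _ _ _ X _](ireprK (irepr_wf t)).
  by rewrite -[X in @mrg _ _ _ _ _ X](ireprK (irepr_wf s)); apply: imrg_cls.
by rewrite (ext_cong (irepr_cong _) (irepr_wf _)).
Qed.

Definition extension : morphism (inflate X) (inflate Z) :=
  Morphism ext_is_morphism.

End Extension.

Definition inflate_mor (X Y : mergeBicat) (f : morphism X Y) :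
    morphism (inflate X) (inflate Y) :=
  extension (comp_mor (eta Y) f).

Definition mu (X : mergeBicat) : morphism (inflate (inflate X)) (inflate X) :=
  extension (id_mor (inflate X)).

Definition is_algebra (X : mergeBicat) (alpha : morphism (inflate X) X) : Prop :=
  comp_mor alpha (eta X) = id_mor X /\
  comp_mor alpha (inflate_mor alpha) = comp_mor alpha (mu X).

(* Main.v *)
From mathcomp Require Import all_boot.
From mathcomp Require Import boolp.
Require Import Defs.

(** An algebra structure for the inflate monad is the same thing as a coherent
    choice of weak units, and 0-representability says that such a choice exists.
    The middle term is [unitors X]: a 1-cell [cu x] on every 0-cell x, units on
    1-cells, and unitors l_a : (cu x, a) -> (a), r_a : (a, cu y) -> (a) with
    inverses l'_a, r'_a, subject to the equations that the inflation imposes on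
    its generators.  Below, p ; q stands for a merge of p into q.

    Algebras and unitors.  Inflation adds unitors freely: a morphism from X to
    a merge-bicategory with unitors extends in a unique way to a morphism on
    the inflation that preserves unitors ([fold], [inflate_mor_ext]).  Extending
    the identity gives an algebra, because both composites in its associativity
    law preserve unitors and agree on the cells of X ([fold_algebra]).
    Conversely, an algebra carries the unitors of the inflation to unitors of X
    ([algebra_unitors]); associativity is what identifies the unitors chosen for
    the 1-cell alpha(eps_x) with the images of l and r at eps_x.

    From unitors to 0-representability.  The merge of r'_a and l_b along the new
    1-cell is a unit on (a, b), since the triangle law lets r'_a be traded for
    l'_b; units on longer sequences are merges of these ([unitors_unital]).
    Naturality makes l_a and r_a invertible ([lam_inverse]) and makes every
    2-cell (cu x, D) -> (a, G) factor through l_a ([lam_universal]), so [cu x] is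
    a tensor unit.  Reversing the 2-cells exchanges the unitors with their
    inverses, hence [cu x] is a par unit as well.

    From 0-representability to unitors.  In the presence of units, a 2-cell
    with one output, universal there, is invertible ([out_universal_inverse]).  Let e
    be a tensor unit and phi : (e, e) -> (e) an invertible 2-cell.  Whiskering
    with e is bijective on 2-cells, so there are unique l_a and r_a whose
    whiskerings by e are phi beside a.  Naturality follows by cancelling the
    whiskering ([kock_nat]); on (a, e, e, b), absorbing one e into a or into b
    can be traded for phi, and cancelling phi leaves the triangle law
    ([kock_triangle]); applied to (e, e), the triangle law gives
    l_e = phi = r_e ([kock_phi]).  The inverses come from whiskering the inverse
    of phi.  This is the argument of Saavedra and Kock for weak units.

    Strength.  The units on pairs are built from unitors, so the extension alpha
    of the identity preserves them, hence preserves invertible 2-cells and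
    tensors.  Let e be a tensor universal 1-cell of the inflation that comes from
    X, and let t : (e, a) -> (c) witness it.  A 2-cell of X that should factor
    through the image of t is lifted to the inflation, factored there, and
    projected back; the factor is unique since e has a left inverse up to an
    invertible 2-cell (u', e) -> (cu x) ([invertible_cancel]).  The 1-cells eps_x
    go to tensor units.  Pars are treated by reversal. *)

Set Implicit Arguments.
Unset Strict Implicit.
Unset Printing Implicit Defensive.

(** * Pasting three 2-cells *)

Lemma splice_catE (T : Type) (s1 s s2 r : seq T) i l :
  i = size s1 -> l = size s -> splice i l (s1 ++ s ++ s2) r = s1 ++ r ++ s2.
Proof. by move=> -> ->; apply: splice_cat. Qed.

Lemma slice_catE (T : Type) (s1 s s2 : seq T) i l :
  i = size s1 -> l = size s -> take l (drop i (s1 ++ s ++ s2)) = s.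
Proof. by move=> -> ->; rewrite drop_size_cat // take_size_cat. Qed.

Lemma cat_nil (T : Type) (A B : seq T) :
  (A ++ B = [::]) = (A = [::] /\ B = [::]).
Proof. by apply/propext; case: A B => [|? ?] [|? ?]; split=> // -[]. Qed.

Lemma cons_nil (T : Type) (a : T) (A : seq T) : (a :: A = [::]) = False.
Proof. by apply/propext. Qed.

Lemma nil_nil (T : Type) : ([::] = [::] :> seq T) = True.
Proof. by apply/propext. Qed.

Definition nilE := (cat_nil, cons_nil, nil_nil).

(* The planarity conditions of a merge are disjunctions of such equations; with
   explicit segments they are decided by looking at one side. *)
#[local] Hint Extern 0 (_ \/ _) =>
  solve [left; reflexivity | right; reflexivity | left; assumption
        | right; assumption] : core.
#[local] Hint Extern 0 (_ <> [::]) => discriminate : core.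

(** The ports of the two bracketings of [mrg_assoc], cut into blocks: the blocks of
    p are named a, b, c, those of q d, c', e, m, and those of r f, b', m'.  Primed
    blocks are glued to unprimed ones of the same name. *)
Lemma ports_assoc (T : eqType) (a1 b1 c b2 a2 d1 c' d2 e1 m e2 f1 b1' m' b2' f2
    ip or : seq T) j1 i1 l1 j2 i2 l2 j3 i3 l3 j4 i4 l4 :
  b1 = [::] \/ e1 = [::] -> b2 = [::] \/ e2 = [::] ->
  b1' = [::] \/ d1 = [::] -> b2' = [::] \/ d2 = [::] ->
  size b1 = size b1' -> size b2 = size b2' -> size c = size c' ->
  size m = size m' ->
  j1 = size (a1 ++ b1) -> i1 = size d1 -> l1 = size c ->
  j2 = size (a1 ++ e1) -> i2 = size f1 -> l2 = size (b1 ++ m ++ b2) ->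
  j3 = size e1 -> i3 = size (f1 ++ b1) -> l3 = size m ->
  j4 = size a1 -> i4 = size (f1 ++ d1) -> l4 = size (b1 ++ c ++ b2) ->
  let op := a1 ++ b1 ++ c ++ b2 ++ a2 in
  let iq := d1 ++ c' ++ d2 in
  let oq := e1 ++ m ++ e2 in
  let ir := f1 ++ b1' ++ m' ++ b2' ++ f2 in
  [/\ zip (take l2 (drop j2 (splice j1 l1 op oq))) (take l2 (drop i2 ir)) ++
        (zip (take l1 (drop j1 op)) (take l1 (drop i1 iq)) ++ [::]) ++ [::]
      =i zip (take l4 (drop j4 op)) (take l4 (drop i4 (splice i3 l3 ir iq))) ++
        zip (take l3 (drop j3 oq)) (take l3 (drop i3 ir)) ++ [::],
      splice i2 l2 ir (splice i1 l1 iq ip) = splice i4 l4 (splice i3 l3 ir iq) ip &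
      splice j2 l2 (splice j1 l1 op oq) or = splice j4 l4 op (splice j3 l3 oq or)].
Proof.
move=> h1 h2 h3 h4 sb1 sb2 sc sm ej1 ei1 el1 ej2 ei2 el2 ej3 ei3 el3 ej4 ei4 el4.
move=> op iq oq ir.
have sz := (ej1, ei1, el1, ej2, ei2, el2, ej3, ei3, el3, ej4, ei4, el4,
  size_cat, sb1, sb2, sc, sm).
have E1 : splice j1 l1 op oq = (a1 ++ e1) ++ (b1 ++ m ++ b2) ++ (e2 ++ a2).
  rewrite /op catA splice_catE //.
  by rewrite /oq; case: h1 h2 => -> [] ->; rewrite ?cats0 -?catA ?cat0s.
have E2 : splice i3 l3 ir iq = (f1 ++ d1) ++ (b1' ++ c' ++ b2') ++ (d2 ++ f2).
  rewrite /ir catA splice_catE ?sz //.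
  by rewrite /iq; case: h3 h4 => -> [] ->; rewrite ?cats0 -?catA ?cat0s.
have E3 : op = a1 ++ (b1 ++ c ++ b2) ++ a2 by rewrite /op -!catA.
have E4 : ir = f1 ++ (b1' ++ m' ++ b2') ++ f2 by rewrite /ir -!catA.
rewrite E1 E2; split.
- have -> : take l1 (drop j1 op) = c by rewrite /op catA slice_catE.
  have -> : take l3 (drop i3 ir) = m'.
    by rewrite /ir catA slice_catE ?sz.
  rewrite E3 E4 !slice_catE ?sz //.
  move=> x; rewrite !zip_cat // !cats0 !mem_cat.
  by do !case: (x \in _).
- rewrite E4 !splice_catE ?sz //.
  by rewrite -!catA.
- rewrite E3 !splice_catE ?sz //.
  by rewrite -!catA.
Qed.

Lemma ports_swap (T : eqType) (a1 c m g2 f1 c' f2 m' f3 ip iq or : seq T)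
    j1 i1 l1 j2 i2 l2 j3 i3 l3 j4 i4 l4 :
  size c = size c' -> size m = size m' ->
  j1 = 0 -> i1 = size (f1 ++ c' ++ f2) -> l1 = size m ->
  j2 = size a1 -> i2 = size f1 -> l2 = size c ->
  j3 = size a1 -> i3 = size f1 -> l3 = size c ->
  j4 = 0 -> i4 = size (f1 ++ ip ++ f2) -> l4 = size m ->
  let op := a1 ++ c in
  let oq := m ++ g2 in
  let ir := f1 ++ c' ++ f2 ++ m' ++ f3 in
  [/\ zip (take l2 (drop j2 op)) (take l2 (drop i2 (splice i1 l1 ir iq))) ++
        zip (take l1 (drop j1 oq)) (take l1 (drop i1 ir)) ++ [::]
      =i zip (take l4 (drop j4 oq)) (take l4 (drop i4 (splice i3 l3 ir ip))) ++
        zip (take l3 (drop j3 op)) (take l3 (drop i3 ir)) ++ [::],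
      splice i2 l2 (splice i1 l1 ir iq) ip = splice i4 l4 (splice i3 l3 ir ip) iq &
      splice j2 l2 op (splice j1 l1 oq or) = splice j4 l4 oq (splice j3 l3 op or)].
Proof.
move=> sc sm -> -> -> -> -> -> -> -> -> -> -> -> op oq ir.
have sz := (size_cat, sc, sm).
have E1 : splice (size (f1 ++ c' ++ f2)) (size m) ir iq =
    f1 ++ c' ++ (f2 ++ iq ++ f3).
  rewrite (_ : ir = (f1 ++ c' ++ f2) ++ m' ++ f3); last by rewrite /ir -!catA.
  by rewrite splice_catE // -!catA.
have E2 : splice (size f1) (size c) ir ip = (f1 ++ ip ++ f2) ++ m' ++ f3.
  by rewrite splice_catE // -!catA.
have E3 : op = a1 ++ c ++ [::] by rewrite /op cats0.
have E4 : ir = (f1 ++ c' ++ f2) ++ m' ++ f3 by rewrite /ir -!catA.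
have E5 : oq = [::] ++ m ++ g2 by [].
rewrite E1 E2; split.
- have -> : take (size c) (drop (size f1) ir) = c' by rewrite slice_catE.
  rewrite E3 E4 E5 !slice_catE //.
  by move=> x; rewrite !cats0 !mem_cat orbC.
- by rewrite !splice_catE // -!catA.
- by rewrite E3 E5 !splice_catE // !cats0 ?cat0s -?catA.
Qed.

Section Assoc.
Variable X : mergeBicat.
Implicit Types (t s p q r : cell2 X) (A B C D G L M : seq (cell1 X)).

Lemma glue_mergeable A L B G D j i l t s :
  outp t = A ++ L ++ B -> inp s = G ++ L ++ D -> L <> [::] ->
  G = [::] \/ A = [::] -> D = [::] \/ B = [::] ->
  j = size A -> i = size G -> l = size L ->
  mergeable j i l (outp t) (inp s).
Proof.
move=> -> -> L0 h1 h2 -> -> ->; apply/mergeableP.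
by exists A, B, G, D, L.
Qed.

Lemma mrg_bd A L B G D j i l t s :
  outp t = A ++ L ++ B -> inp s = G ++ L ++ D -> L <> [::] ->
  G = [::] \/ A = [::] -> D = [::] \/ B = [::] ->
  j = size A -> i = size G -> l = size L ->
  inp (mrg j i l t s) = G ++ inp t ++ D /\
  outp (mrg j i l t s) = A ++ outp s ++ B.
Proof.
move=> e f L0 h1 h2 ej ei el.
have m := glue_mergeable e f L0 h1 h2 ej ei el.
rewrite (inp_mrg (maxioms X) m) (outp_mrg (maxioms X) m) e f.
by rewrite !splice_catE.
Qed.

Definition cells3 p q r (k : 'I_3) : cell2 X := nth p [:: p; q; r] k.
Definition ports (k : 'I_3) n l : seq ('I_3 * nat) :=
  [seq (k, m) | m <- iota n l].

Lemma ports_cat k n A B :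
  ports k n (size (A ++ B)) = ports k n (size A) ++ ports k (n + size A) (size B).
Proof. by rewrite /ports size_cat iotaD map_cat. Qed.

Lemma size_ports k n l : size (ports k n l) = l.
Proof. by rewrite size_map size_iota. Qed.

Local Notation o0 := (@Ordinal 3 0 isT).
Local Notation o1 := (@Ordinal 3 1 isT).
Local Notation o2 := (@Ordinal 3 2 isT).

Lemma perm3 (s : seq 'I_3) : uniq s -> o0 \in s -> o1 \in s -> o2 \in s ->
  perm_eq s (enum 'I_3).
Proof.
move=> u h0 h1 h2; apply: uniq_perm => //; first exact: enum_uniq.
move=> x; rewrite mem_enum; case: x => [[|[|[|//]]] h].
- by rewrite (_ : Ordinal h = o0) //; apply: val_inj.
- by rewrite (_ : Ordinal h = o1) //; apply: val_inj.
- by rewrite (_ : Ordinal h = o2) //; apply: val_inj.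
Qed.

(** Three 2-cells in a row: p and q are glued along L, q and r along M, and p and
    r may also be glued directly, along N1 on the left and N2 on the right of q.
    Both bracketings glue the same ports, so that coherence identifies them.  The
    alternatives say that the pasting diagram is planar.  The positions are left
    as variables with equations, since they are met in various normal forms. *)
Lemma mrg_assoc P1 N1 L N2 P2 Q1 Q2 S1 M S2 R1 R2 p q r j1 i1 l1 j2 i2 l2 j3 i3 l3
    j4 i4 l4 :
  outp p = P1 ++ N1 ++ L ++ N2 ++ P2 -> inp q = Q1 ++ L ++ Q2 ->
  outp q = S1 ++ M ++ S2 -> inp r = R1 ++ N1 ++ M ++ N2 ++ R2 ->
  L <> [::] -> M <> [::] ->
  N1 = [::] \/ S1 = [::] -> N2 = [::] \/ S2 = [::] ->
  Q1 = [::] \/ P1 ++ N1 = [::] -> Q2 = [::] \/ N2 ++ P2 = [::] ->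
  R1 = [::] \/ P1 ++ S1 = [::] -> R2 = [::] \/ S2 ++ P2 = [::] ->
  j1 = size (P1 ++ N1) -> i1 = size Q1 -> l1 = size L ->
  j2 = size (P1 ++ S1) -> i2 = size R1 -> l2 = size (N1 ++ M ++ N2) ->
  j3 = size S1 -> i3 = size (R1 ++ N1) -> l3 = size M ->
  j4 = size P1 -> i4 = size (R1 ++ Q1) -> l4 = size (N1 ++ L ++ N2) ->
  mrg j2 i2 l2 (mrg j1 i1 l1 p q) r = mrg j4 i4 l4 p (mrg j3 i3 l3 q r).
Proof.
move=> ep eq1 eq2 er L0 M0 hN1 hN2 hQ1 hQ2 hR1 hR2 -> -> -> -> -> -> -> -> -> -> -> ->.
have hS1 : R1 ++ N1 = [::] \/ S1 = [::].
  by clear - hN1 hR1; move: hN1 hR1; rewrite !nilE; tauto.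
have hS2 : N2 ++ R2 = [::] \/ S2 = [::].
  by clear - hN2 hR2; move: hN2 hR2; rewrite !nilE; tauto.
have hQN1 : N1 = [::] \/ Q1 = [::].
  by clear - hQ1; move: hQ1; rewrite !nilE; tauto.
have hQN2 : N2 = [::] \/ Q2 = [::].
  by clear - hQ2; move: hQ2; rewrite !nilE; tauto.
have hP1 : R1 ++ Q1 = [::] \/ P1 = [::].
  by clear - hQ1 hR1; move: hQ1 hR1; rewrite !nilE; tauto.
have hP2 : Q2 ++ R2 = [::] \/ P2 = [::].
  by clear - hQ2 hR2; move: hQ2 hR2; rewrite !nilE; tauto.
have K0 (K : seq (cell1 X)) : K <> [::] -> N1 ++ K ++ N2 <> [::].
  by clear; case: N1 => //; case: K.
have [b1 b2] :
  inp (mrg (size (P1 ++ N1)) (size Q1) (size L) p q) = Q1 ++ inp p ++ Q2 /\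
  outp (mrg (size (P1 ++ N1)) (size Q1) (size L) p q) =
    (P1 ++ N1) ++ outp q ++ (N2 ++ P2).
  by apply: (@mrg_bd (P1 ++ N1) L (N2 ++ P2) Q1 Q2); rewrite // ep -!catA.
have [b3 b4] :
  inp (mrg (size S1) (size (R1 ++ N1)) (size M) q r) =
    (R1 ++ N1) ++ inp q ++ (N2 ++ R2) /\
  outp (mrg (size S1) (size (R1 ++ N1)) (size M) q r) = S1 ++ outp r ++ S2.
  by apply: (@mrg_bd S1 M S2 (R1 ++ N1) (N2 ++ R2));
    rewrite // ?er -?catA //; case: hS1 hS2; auto.
pose T1 := Node (size (P1 ++ S1)) (size R1) (size (N1 ++ M ++ N2))
  (Node (size (P1 ++ N1)) (size Q1) (size L) (Leaf o0) (Leaf o1)) (Leaf o2).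
pose T2 := Node (size P1) (size (R1 ++ Q1)) (size (N1 ++ L ++ N2))
  (Leaf o0) (Node (size S1) (size (R1 ++ N1)) (size M) (Leaf o1) (Leaf o2)).
apply: (@mrg_coherent X (maxioms X) (cells3 p q r) T1 T2).
- split; first exact: perm3.
  split=> //=; first split=> //; rewrite /cells3 /=.
    by apply: (@glue_mergeable (P1 ++ N1) L (N2 ++ P2) Q1 Q2); rewrite // ep -!catA.
  apply: (@glue_mergeable (P1 ++ S1) (N1 ++ M ++ N2) (S2 ++ P2) R1 R2);
   rewrite // ?b2 ?er ?eq2 -?catA //.
  by case: hN1 hN2 => -> [] ->; rewrite ?cats0 -?catA.
  exact: K0.
- split; first exact: perm3.
  split=> //=; first split=> //; rewrite /cells3 /=.
    by apply: (@glue_mergeable S1 M S2 (R1 ++ N1) (N2 ++ R2)); rewrite ?er -?catA //.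
  apply: (@glue_mergeable P1 (N1 ++ L ++ N2) P2 (R1 ++ Q1) (Q2 ++ R2));
   rewrite // ?b3 ?ep ?eq1 -?catA //.
  by case: hQN1 hQN2 => -> [] ->; rewrite ?cats0 -?catA.
  exact: K0.
rewrite /T1 /T2 /same_diagram /= /cells3 /= ep eq1 eq2 er.
rewrite -!/(ports _ 0 _) !ports_cat !add0n.
move: (ports o0 0 (size (inp p))) (ports o2 0 (size (outp r))) => ip or.
by apply: ports_assoc; rewrite ?size_cat ?size_ports //;
  [case: hN1|case: hN2|case: hQN1|case: hQN2] => ->; by [left|right].
Qed.

(** Two 2-cells p and q that feed disjoint inputs L and M of r, with p on the left,
    can be merged into r in either order. *)
Lemma mrg_swap P1 L M Q2 R1 R2 R3 p q r j1 i1 l1 j2 i2 l2 j3 i3 l3 j4 i4 l4 :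
  outp p = P1 ++ L -> outp q = M ++ Q2 ->
  inp r = R1 ++ L ++ R2 ++ M ++ R3 ->
  L <> [::] -> M <> [::] ->
  R1 = [::] \/ P1 = [::] -> R3 = [::] \/ Q2 = [::] ->
  j1 = 0 -> i1 = size (R1 ++ L ++ R2) -> l1 = size M ->
  j2 = size P1 -> i2 = size R1 -> l2 = size L ->
  j3 = size P1 -> i3 = size R1 -> l3 = size L ->
  j4 = 0 -> i4 = size (R1 ++ inp p ++ R2) -> l4 = size M ->
  mrg j2 i2 l2 p (mrg j1 i1 l1 q r) = mrg j4 i4 l4 q (mrg j3 i3 l3 p r).
Proof.
move=> ep eq er L0 M0 h1 h2 -> -> -> -> -> -> -> -> -> -> -> ->.
have m1 := @glue_mergeable [::] M Q2 (R1 ++ L ++ R2) R3.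
have b1 := @mrg_bd [::] M Q2 (R1 ++ L ++ R2) R3.
have m3 := @glue_mergeable P1 L [::] R1 (R2 ++ M ++ R3).
have b3 := @mrg_bd P1 L [::] R1 (R2 ++ M ++ R3).
have [c1 d1] := b1 0 _ _ q r eq ltac:(by rewrite -!catA) M0 ltac:(by []) h2
  erefl erefl erefl.
have [c3 d3] := b3 _ _ _ p r ltac:(by rewrite cats0) ltac:(by rewrite er -?catA)
  L0 h1 ltac:(by []) erefl erefl erefl.
pose T1 := Node (size P1) (size R1) (size L) (Leaf o0)
  (Node 0 (size (R1 ++ L ++ R2)) (size M) (Leaf o1) (Leaf o2)).
pose T2 := Node 0 (size (R1 ++ inp p ++ R2)) (size M) (Leaf o1)
  (Node (size P1) (size R1) (size L) (Leaf o0) (Leaf o2)).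
apply: (@mrg_coherent X (maxioms X) (cells3 p q r) T1 T2).
- split; first exact: perm3.
  split=> //=; first split=> //; rewrite /cells3 /=.
    by apply: m1; rewrite ?er -?catA.
  apply: (@glue_mergeable P1 L [::] R1 (R2 ++ inp q ++ R3)) => //.
    by rewrite cats0.
  by rewrite c1 -!catA.
- split; first exact: perm3.
  split=> //=; first split=> //; rewrite /cells3 /=.
    by apply: m3; rewrite ?cats0 ?er -?catA.
  apply: (@glue_mergeable [::] M Q2 (R1 ++ inp p ++ R2) R3) => //.
  by rewrite c3 -!catA.
rewrite /T1 /T2 /same_diagram /= /cells3 /= ep eq er.
rewrite -!/(ports _ 0 _) !ports_cat !add0n.
move: (ports o0 0 (size (inp p))) (size_ports o0 0 (size (inp p))) => ip sp.
move: (ports o1 0 (size (inp q))) (ports o2 0 (size (outp r))) => iq or.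
by apply: ports_swap; rewrite ?size_cat ?size_ports ?sp.
Qed.
End Assoc.

(** * Reversal of 2-cells *)

Lemma mergeable_sym (T : Type) j i l (D G : seq T) :
  mergeable j i l D G -> mergeable i j l G D.
Proof. by case=> -[? ? ?] e h1 h2; split=> //; apply/or_comm. Qed.

Section Opposite.
Variable X : mergeBicat.

(** Reversing 2-cells turns a bracketing upside down; inputs and outputs trade
    places. *)
Fixpoint flip (T : mtree) : mtree :=
  match T with
  | Leaf k => Leaf k
  | Node j i l T1 T2 => Node i j l (flip T2) (flip T1)
  end.

Variable c : 'I_3 -> cell2 X.
Let swap (x : ('I_3 * nat) * ('I_3 * nat)) := (x.2, x.1).

Lemma flip_eval T : @eval (opd X) c T = eval c (flip T).
Proof. by elim: T => //= j i l T1 -> T2 ->. Qed.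

Lemma flip_evaluable T : @evaluable (opd X) c T -> evaluable c (flip T).
Proof.
elim: T => //= j i l T1 IH1 T2 IH2 [/IH1 v1 /IH2 v2 m]; split=> //.
by rewrite -!flip_eval; apply: mergeable_sym.
Qed.

Lemma flip_leaves T : perm_eq (leaves (flip T)) (leaves T).
Proof. by elim: T => //= _ _ _ T1 h1 T2 h2; rewrite perm_catC perm_cat. Qed.

Lemma flip_ports T : @in_ports (opd X) c T = out_ports c (flip T) /\
  @out_ports (opd X) c T = in_ports c (flip T).
Proof. by elim: T => //= j i l T1 [-> ->] T2 [-> ->]. Qed.

Lemma flip_glued T : map swap (@glued (opd X) c T) =i glued c (flip T).
Proof.
elim: T => //= j i l T1 IH1 T2 IH2 x.
have [e1 f1] := flip_ports T1; have [e2 f2] := flip_ports T2.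
rewrite !map_cat !mem_cat IH1 IH2 f1 e2 (orbC (x \in glued c (flip T1))).
congr (_ || _); move: (take _ _) (take _ _) => s t.
by elim: s t => [|a s IH] [|b t] //=; rewrite !in_cons IH.
Qed.

Lemma flip_diagram T T' : @same_diagram (opd X) c T T' ->
  same_diagram c (flip T) (flip T').
Proof.
have [e1 f1] := flip_ports T; have [e2 f2] := flip_ports T'.
case=> h; rewrite e1 f1 e2 f2 => hi ho; split=> // x.
by rewrite -!flip_glued; apply: eq_mem_map.
Qed.

End Opposite.

Lemma opd_is_mergeBicat (X : mergeBicat) : is_mergeBicat (opd X).
Proof.
split=> /= [p|p|p|j i l t s /mergeable_sym m|j i l t s /mergeable_sym m|].
- exact: outp_neq0 (maxioms X) p.
- exact: inp_neq0 (maxioms X) p.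
- by have [x [y [h k]]] := parallel (maxioms X) p; exists x, y.
- exact: (@outp_mrg X (maxioms X) i j l s t m).
- exact: (@inp_mrg X (maxioms X) i j l s t m).
move=> c T T' [p v] [p' v'] d; rewrite !flip_eval.
apply: (mrg_coherent (maxioms X)); last exact: flip_diagram.
  by split; [rewrite (permPl (flip_leaves T))|apply: flip_evaluable].
by split; [rewrite (permPl (flip_leaves T'))|apply: flip_evaluable].
Qed.

Definition op_mergeBicat (X : mergeBicat) : mergeBicat :=
  MergeBicat (opd_is_mergeBicat X).

(** * Units and invertible 2-cells *)

Section Isos.
Variable X : mergeBicat.
Implicit Types (t s p q r u : cell2 X) (A B C D G L M : seq (cell1 X)).

Lemma unit_out G u A B p j l : is_unit G u -> G <> [::] ->
  outp p = A ++ G ++ B -> j = size A -> l = size G -> mrg j 0 l p u = p.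
Proof.
case=> ei _ h _ G0 e -> ->; apply: h.
by apply: (@glue_mergeable _ A G B [::] [::]); rewrite // ei cats0.
Qed.

Lemma unit_in G u A B p i l : is_unit G u -> G <> [::] ->
  inp p = A ++ G ++ B -> i = size A -> l = size G -> mrg 0 i l u p = p.
Proof.
case=> _ eo _ h G0 e -> ->; apply: h.
by apply: (@glue_mergeable _ [::] G [::] A B); rewrite // eo cats0.
Qed.

Lemma unit_uniq G u u' : G <> [::] -> is_unit G u -> is_unit G u' -> u = u'.
Proof.
move=> G0 hu hu'.
have e : mrg 0 0 (size G) u u' = u.
  by apply: (@unit_out G _ [::] [::]); rewrite ?cats0 //; case: hu.
by rewrite -e; apply: (@unit_in G _ [::] [::]); rewrite ?cats0 //; case: hu'.
Qed.

Definition inverse G D t t' : Prop :=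
  [/\ inp t = G /\ outp t = D, inp t' = D /\ outp t' = G,
      is_unit G (mrg 0 0 (size D) t t') & is_unit D (mrg 0 0 (size G) t' t)].

Lemma inverse_sym G D t t' : inverse G D t t' -> inverse D G t' t.
Proof. by case. Qed.

Lemma inverse_neq0 G D t t' : inverse G D t t' -> G <> [::] /\ D <> [::].
Proof.
case=> -[<- <-] _ _ _; split; first exact: inp_neq0 (maxioms X) t.
exact: outp_neq0 (maxioms X) t.
Qed.

Lemma inverse_outK G D t t' A B q j l l' : inverse G D t t' ->
  outp q = A ++ G ++ B -> j = size A -> l = size G -> l' = size D ->
  mrg j 0 l' (mrg j 0 l q t) t' = q.
Proof.
move=> v e -> -> ->; have [G0 D0] := inverse_neq0 v.
case: v => [[e1 e2] [e3 e4] u _].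
transitivity (mrg (size A) 0 (size G) q (mrg 0 0 (size D) t t')).
  by apply: (@mrg_assoc _ A [::] G [::] B [::] [::] [::] D [::] [::] [::]);
    rewrite ?cats0 // ?e ?e2.
exact: (unit_out u G0 e).
Qed.

Lemma inverse_inK G D t t' A B q i l l' : inverse G D t t' ->
  inp q = A ++ G ++ B -> i = size A -> l = size G -> l' = size D ->
  mrg 0 i l' t (mrg 0 i l t' q) = q.
Proof.
move=> v e -> -> ->; have [G0 D0] := inverse_neq0 v.
case: v => [[e1 e2] [e3 e4] u _].
transitivity (mrg 0 (size A) (size G) (mrg 0 0 (size D) t t') q).
  by apply/esym; apply: (@mrg_assoc _ [::] [::] D [::] [::] [::] [::] [::] G [::] A B);
    rewrite ?cats0 // ?e ?e2.
exact: (unit_in u G0 e).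
Qed.

Lemma inverse_out_inj G D t t' A B q q' j l : inverse G D t t' ->
  outp q = A ++ G ++ B -> outp q' = A ++ G ++ B -> j = size A -> l = size G ->
  mrg j 0 l q t = mrg j 0 l q' t -> q = q'.
Proof.
move=> v e e' ej el E.
by rewrite -(inverse_outK v e ej el erefl) E (inverse_outK v e' ej el erefl).
Qed.

Lemma inverse_in_inj G D t t' A B q q' i l : inverse G D t t' ->
  inp q = A ++ D ++ B -> inp q' = A ++ D ++ B -> i = size A -> l = size D ->
  mrg 0 i l t q = mrg 0 i l t q' -> q = q'.
Proof.
move=> /inverse_sym v e e' ei el E.
by rewrite -(inverse_inK v e ei el erefl) E (inverse_inK v e' ei el erefl).
Qed.

(** A 2-cell s factors through an invertible t as t followed by the merge of t'
    into s. *)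
Lemma inverse_out_universal G c t t' : inverse G [:: c] t t' ->
  out_universal t 0.
Proof.
move=> v; have [G0 _] := inverse_neq0 v; have [[e1 e2] [e3 e4] _ _] := v.
exists [::], c, [::]; split=> // G1 G2 D s D0 _ _ es fs.
rewrite /= cats0 in fs; rewrite e1 in es.
have [f1 f2] : inp (mrg 0 (size G1) (size G) t' s) = G1 ++ [:: c] ++ G2 /\
    outp (mrg 0 (size G1) (size G) t' s) = D.
  have [] := @mrg_bd X [::] G [::] G1 G2 0 (size G1) (size G) t' s;
    by rewrite ?cats0 // e3 fs.
exists (mrg 0 (size G1) (size G) t' s); split.
  by split=> //; apply: inverse_inK v es _ _ _.
move=> r [h1 h2 h3]; rewrite -h3.
exact: (inverse_inK (inverse_sym v) h1 _ _ _).
Qed.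

(** The inverse is the factor t' of the unit on G.  Both t' ; t and the unit on c
    are factors of t through itself, hence equal. *)
Lemma out_universal_inverse G c t u1 u2 : inp t = G -> outp t = [:: c] ->
  is_unit G u1 -> is_unit [:: c] u2 -> out_universal t 0 ->
  exists t', inverse G [:: c] t t'.
Proof.
move=> e1 e2 hu1 hu2 [D1 [a [D2 []]]]; rewrite e2.
case: D1 => // -[<- <-] _ H.
have G0 : G <> [::] by rewrite -e1; apply: inp_neq0 (maxioms X) t.
have [t' [[f1 f2 f3] _]] : exists! r,
    [/\ inp r = [:: c], outp r = G & mrg 0 0 1 t r = u1].
  have := H [::] [::] G u1 G0; rewrite !cats0 e1 /=; apply=> //.
    by case: hu1.
  by case: hu1.
exists t'; split=> //; first by rewrite f3.
suff -> : mrg 0 0 (size G) t' t = u2 by [].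
have [r [_ U]] : exists! r, [/\ inp r = [:: c], outp r = [:: c] & mrg 0 0 1 t r = t].
  by have := H [::] [::] [:: c] t ltac:(done); rewrite !cats0 e1 /=; apply.
have [g1 g2] : inp (mrg 0 0 (size G) t' t) = [:: c] /\
    outp (mrg 0 0 (size G) t' t) = [:: c].
  by have [] := @mrg_bd X [::] G [::] [::] [::] 0 0 (size G) t' t;
    rewrite ?cats0 // f1 e2.
rewrite -(U (mrg 0 0 (size G) t' t)) ?(U u2) //.
  split=> //; try by case: hu2.
  exact: (@unit_out [:: c] _ [::] [::]).
split=> //.
transitivity (mrg 0 0 (size G) u1 t).
  rewrite -f3; apply/esym.
  by apply: (@mrg_assoc _ [::] [::] [:: c] [::] [::] [::] [::] [::] G [::] [::] [::]);
    rewrite ?cats0.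
by apply: (@unit_in G _ [::] [::]); rewrite // ?cats0.
Qed.

End Isos.

(** A unit is merged along the whole of its boundary, so that these are the only two
    positions to check. *)
Lemma unitI (X : mergeBicat) (G : seq (cell1 X)) (u : cell2 X) :
  inp u = G -> outp u = G ->
  (forall A B p, outp p = A ++ G ++ B -> mrg (size A) 0 (size G) p u = p) ->
  (forall A B p, inp p = A ++ G ++ B -> mrg 0 (size A) (size G) u p = p) ->
  is_unit G u.
Proof.
move=> ei eo ho hi; split=> // i p /mergeableP [P1 [P2 [G1 [G2 [L]]]]].
  rewrite ei => -[[e f _] [ej /size0nil e1 el] _ _]; move: f; rewrite e1 /= => f.
  have G20 : G2 = [::].
    by apply: size0nil; apply: (@addnI (size L)); rewrite -size_cat -f el addn0.
  by rewrite -ej; apply: (ho _ P2); rewrite e f G20 cats0.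
rewrite eo => -[[e f _] [/size0nil e1 ej el] _ _]; move: e; rewrite e1 /= => e.
have P20 : P2 = [::].
  by apply: size0nil; apply: (@addnI (size L)); rewrite -size_cat -e el addn0.
by rewrite -ej; apply: (hi _ G2); rewrite f e P20 cats0.
Qed.

(** * Unitors *)

Section Sides.
Variable T : Type.
Implicit Types (s : bool) (e a : T) (A B : seq T).

(** The left-hand and the right-hand version of each construction are treated at
    once: [s = true] stands for the left, and [pad s e a] is a with e on its side
    s.  Coerced to a number, s is the position of a in it, and [~~ s] is that of
    e. *)
Definition padl s e : seq T := if s then [:: e] else [::].
Definition padr s e : seq T := if s then [::] else [:: e].
Definition pad s e a : seq T := padl s e ++ a :: padr s e.

(** For a sequence with a distinguished entry, preceded by A and followed by B: the
    entry stands at the end of the sequence on side s.  This is the planarity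
    condition for merging with [pad s e a] along a. *)
Definition extremal s A B : Prop := if s then A = [::] else B = [::].

Lemma size_padl s e : size (padl s e) = s.
Proof. by case: s. Qed.

Lemma size_padr s e : size (padr s e) = ~~ s.
Proof. by case: s. Qed.

Lemma size_pad s e a : size (pad s e a) = 2.
Proof. by case: s. Qed.

Lemma extremal_l s e A B : extremal s A B -> padl s e = [::] \/ A = [::].
Proof. by case: s. Qed.

Lemma extremal_r s e A B : extremal s A B -> padr s e = [::] \/ B = [::].
Proof. by case: s. Qed.

End Sides.

Lemma pad_map (T T' : Type) (h : T -> T') s e a :
  map h (pad s e a) = pad s (h e) (h a).
Proof. by case: s. Qed.

Lemma padl_map (T T' : Type) (h : T -> T') s e : map h (padl s e) = padl s (h e).
Proof. by case: s. Qed.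

Lemma padr_map (T T' : Type) (h : T -> T') s e : map h (padr s e) = padr s (h e).
Proof. by case: s. Qed.

Lemma extremal_map (T T' : Type) (h : T -> T') s A B :
  extremal s A B -> extremal s (map h A) (map h B).
Proof. by case: s => /= ->. Qed.

Lemma pad_split (T : Type) s (e a : T) :
  pad s e a = padl (~~ s) a ++ [:: e] ++ padr (~~ s) a.
Proof. by case: s. Qed.

Lemma mergeable_padl (T : Type) s (A : seq T) a B e : extremal s A B ->
  mergeable (size A) s 1 (A ++ a :: B) (pad s e a).
Proof.
move=> ext; apply/mergeableP; exists A, B, (padl s e), (padr s e), [:: a].
rewrite size_padl; split=> //; first exact: extremal_l ext.
exact: extremal_r ext.
Qed.

Lemma pad_neq0 (T : Type) s (e a : T) : pad s e a <> [::].
Proof. by case: s. Qed.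

Definition endpt (X : mergeData) (s : bool) (a : cell1 X) : cell0 X :=
  if s then src a else tgt a.

(** The structure that an inflation adds freely: [cu x] is eps_x, [eps a] is eps_a,
    [lam true a] and [lam false a] are l_a and r_a, and [lam' s a] is the inverse
    of [lam s a]. *)
Record unitors (X : mergeBicat) := Unitors {
  cu : cell0 X -> cell1 X;
  eps : cell1 X -> cell2 X;
  lam : bool -> cell1 X -> cell2 X;
  lam' : bool -> cell1 X -> cell2 X;
  cu_endpt : forall s x, endpt s (cu x) = x;
  eps_unit : forall a, is_unit [:: a] (eps a);
  lam_bd : forall s a,
    inp (lam s a) = pad s (cu (endpt s a)) a /\ outp (lam s a) = [:: a];
  lam'_bd : forall s a,
    inp (lam' s a) = [:: a] /\ outp (lam' s a) = pad s (cu (endpt s a)) a;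
  lam_cu : forall x, lam true (cu x) = lam false (cu x);
  lam'_cu : forall x, lam' true (cu x) = lam' false (cu x);
  lam'K : forall s a, mrg 0 0 2 (lam' s a) (lam s a) = eps a;
  lam_nat : forall s p A a B C b D,
    inp p = A ++ a :: B -> outp p = C ++ b :: D ->
    extremal s A B -> extremal s C D ->
    mrg (size C) s 1 p (lam s b) = mrg 0 (size A) 1 (lam s a) p;
  lam'_nat : forall s p A a B C b D,
    inp p = A ++ a :: B -> outp p = C ++ b :: D ->
    extremal s A B -> extremal s C D ->
    mrg (size C) 0 1 p (lam' s b) = mrg s (size A) 1 (lam' s a) p;
  triangle : forall p A a b B, inp p = A ++ a :: b :: B ->
    mrg 0 (size A) 1 (lam false a) p = mrg 0 (size A).+1 1 (lam true b) p;
  triangle' : forall p A a b B, outp p = A ++ a :: b :: B ->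
    mrg (size A) 0 1 p (lam' false a) = mrg (size A).+1 0 1 p (lam' true b) }.

Lemma op_unit (X : mergeBicat) (G : seq (cell1 X)) (u : cell2 X) :
  @is_unit X G u -> @is_unit (op_mergeBicat X) G u.
Proof.
by case=> ? ? h1 h2; split=> // i p /mergeable_sym; [apply: h2|apply: h1].
Qed.

(** The laws of unitors come in pairs exchanged by reversal. *)
Definition op_unitors (X : mergeBicat) (V : unitors X) : unitors (op_mergeBicat X).
Proof.
refine (@Unitors (op_mergeBicat X) (cu V) (eps V) (lam' V) (lam V)
  _ _ _ _ _ _ _ _ _ _ _).
- exact: (cu_endpt V).
- by move=> a; apply: op_unit; apply: eps_unit.
- by move=> s a; case: (lam'_bd V s a) => *; split.
- by move=> s a; case: (lam_bd V s a) => *; split.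
- exact: (lam'_cu V).
- exact: (lam_cu V).
- exact: (lam'K V).
- by move=> s p A a B C b D h k e f; apply/esym; exact: (@lam'_nat _ V s p C b D A a B).
- by move=> s p A a B C b D h k e f; apply/esym; exact: (@lam_nat _ V s p C b D A a B).
- exact: (triangle' V).
- exact: (triangle V).
Defined.

Section PairUnits.
Variables (X : mergeBicat) (V : unitors X).
Implicit Types (p q r : cell2 X) (a b : cell1 X) (A B C D G : seq (cell1 X)).

Definition pair_id a b := mrg 1 0 1 (lam' V false a) (lam V true b).

Lemma path_pair p A a b B : inp p = A ++ a :: b :: B -> tgt a = src b.
Proof.
have [x [y [h _]]] := parallel (maxioms X) p; move=> e; move: h; rewrite e.
by case/is_path_cat => z /= [_ [_ [->]]].
Qed.

(** Merging p with r'_a and then l_b is, by the triangle law, merging it with l'_b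
    and then l_b, which cancel.  On the input side, l_b merged into p is traded for
    r_a, which r'_a cancels. *)
Lemma pair_id_unit a b : tgt a = src b -> is_unit [:: a; b] (pair_id a b).
Proof.
move=> ab; have [l1 l2] := lam_bd V true b; have [r1 r2] := lam'_bd V false a.
have [s1 s2] := lam_bd V false a; have [m1 m2] := lam'_bd V true b.
rewrite /pad /= ab in l1 r2 s1 m2.
have [u1 u2] : inp (pair_id a b) = [:: a; b] /\ outp (pair_id a b) = [:: a; b].
  have [] := @mrg_bd X [:: a] [:: cu V (src b)] [::] [::] [:: b] 1 0 1
    (lam' V false a) (lam V true b); rewrite // r1 l2; by [].
apply: unitI => // A B p e.
  transitivity (mrg (size A).+1 0 2 (mrg (size A) 0 1 p (lam' V false a))
    (lam V true b)).
    apply/esym; apply: (@mrg_assoc X A [::] [:: a] [:: b] B [::] [::] [:: a]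
      [:: cu V (src b)] [::] [::] [::]);
      by rewrite // ?size_cat ?addn0 ?addn1.
  rewrite (triangle' V e).
  transitivity (mrg (size A).+1 0 1 p (mrg 0 0 2 (lam' V true b) (lam V true b))).
    apply: (@mrg_assoc X (rcons A a) [::] [:: b] [::] B [::] [::] [::]
      [:: cu V (src b); b] [::] [::] [::]);
      by rewrite // ?cats0 ?size_rcons // e -cats1 -catA.
  rewrite lam'K; apply: (unit_out (eps_unit V b)) => //.
    by rewrite e -cat_rcons. by rewrite size_rcons.
transitivity (mrg 0 (size A) 2 (lam' V false a) (mrg 0 (size A).+1 1 (lam V true b) p)).
  apply: (@mrg_assoc X [::] [:: a] [:: cu V (src b)] [::] [::] [::] [:: b] [::]
    [:: b] [::] A B);
  by rewrite // ?size_cat ?addn0 ?addn1.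
rewrite -(triangle V e).
transitivity (mrg 0 (size A) 1 (mrg 0 0 2 (lam' V false a) (lam V false a)) p).
  apply/esym; apply: (@mrg_assoc X [::] [::] [:: a; cu V (src b)] [::] [::] [::] [::] [::] [:: a]
    [::] A (b :: B)); rewrite // ?cats0 //.
rewrite lam'K; exact: (unit_in (eps_unit V a) _ e).
Qed.

End PairUnits.

Section UnitorsTheory.
Variables (X : mergeBicat) (V : unitors X).
Implicit Types (p q r : cell2 X) (a b : cell1 X) (A B C D G : seq (cell1 X)).

(** Naturality of l' along l_a turns l_a ; l'_a into l'_e ; l_a for e = [cu x],
    and l'_e = r'_e makes this the unit on (e, a).  On the right, r'_e = l'_e
    leads to the unit of the same shape in the reversed merge-bicategory. *)
Lemma lam_inverse s a :
  inverse (pad s (cu V (endpt s a)) a) [:: a] (lam V s a) (lam' V s a).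
Proof.
have [e1 e2] := lam_bd V s a; have [f1 f2] := lam'_bd V s a.
split=> //; last by rewrite size_pad lam'K; apply: eps_unit.
case: s e1 e2 f1 f2 => /= e1 e2 f1 f2.
  have := @lam'_nat _ V true (lam V true a) [::] _ [:: a] [::] a [::] e1 e2 erefl erefl.
  move=> /= ->; rewrite lam'_cu; apply: pair_id_unit.
  exact: (cu_endpt V false).
have := @lam'_nat _ V false (lam V false a) [:: a] _ [::] [::] a [::] e1 e2 erefl erefl.
move=> /= ->; rewrite -lam'_cu.
suff: @is_unit (op_mergeBicat X) [:: a; cu V (tgt a)]
    (mrg 0 1 1 (lam' V true (cu V (tgt a))) (lam V false a)).
  exact: op_unit.
apply: (@pair_id_unit (op_mergeBicat X) (op_unitors V)).
exact/esym/(cu_endpt V true).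
Qed.

Lemma unit_cons a b G u : tgt a = src b -> is_unit (b :: G) u ->
  is_unit [:: a, b & G] (mrg 1 0 1 (pair_id V a b) u).
Proof.
move=> /(pair_id_unit V) v w; have [p1 p2 _ _] := v; have [u1 u2 _ _] := w.
have [h1 h2] : inp (mrg 1 0 1 (pair_id V a b) u) = [:: a, b & G] /\
    outp (mrg 1 0 1 (pair_id V a b) u) = [:: a, b & G].
  have [] := @mrg_bd X [:: a] [:: b] [::] [::] G 1 0 1 (pair_id V a b) u;
    by rewrite ?p1 ?p2 ?u1 ?u2 ?cats0 //.
apply: unitI => // A B p e.
  transitivity (mrg (size A).+1 0 (size G).+1 (mrg (size A) 0 2 p (pair_id V a b)) u).
    by apply/esym; apply: (@mrg_assoc X A [::] [:: a; b] G B [::] [::] [:: a]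
      [:: b] [::] [::] [::]);
      rewrite // ?size_cat ?addn0 ?addn1 // ?u1 ?cats0.
  rewrite (unit_out v _ e) //; apply: (unit_out w) => //.
    by rewrite e -cat_rcons.
  by rewrite size_rcons.
transitivity (mrg 0 (size A) 2 (pair_id V a b) (mrg 0 (size A).+1 (size G).+1 u p)).
  by apply: (@mrg_assoc X [::] [:: a] [:: b] [::] [::] [::] G [::] (b :: G) [::] A B);
    rewrite // ?size_cat ?addn0 ?addn1 //= ?cats0 ?size_cat ?addn1 // u2 cats0.
rewrite (unit_in w (A := rcons A a) (B := B)) ?size_rcons // ?e ?cat_rcons //.
exact: (unit_in v _ e).
Qed.

Lemma unitors_unital : unital X.
Proof.
case=> // a G _; elim: G a => [|b G IH] a [x [y]].
  by exists (eps V a); apply: eps_unit.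
move=> /= [_ [ab h]].
have [|u hu] := IH b; first by exists (src b), y; split.
by exists (mrg 1 0 1 (pair_id V a b) u); apply: unit_cons.
Qed.

End UnitorsTheory.

(** * From unitors to 0-representability *)

Definition side_universal (X : mergeData) s (e a c : cell1 X) : Prop :=
  exists t : cell2 X, [/\ inp t = pad s e a, outp t = [:: c],
                          out_universal t 0 & in_universal t s].

Lemma tensor_unitP (X : mergeData) x (e : cell1 X) : is_tensor_unit x e <->
  (forall s, endpt s e = x) /\
  forall s a, endpt s a = x -> side_universal s e a a.
Proof.
split=> [[h1 h2 h3 h4]|[h k]]; first by split=> -[] //.
by split; [exact: (h true)|exact: (h false)|exact: (k true)|exact: (k false)].
Qed.

Lemma tensor_universalP (X : mergeData) (e : cell1 X) : tensor_universal e <->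
  (forall s a, endpt s a = endpt s e -> exists u, side_universal s e u a) /\
  (forall s a, endpt s a = endpt (~~ s) e -> exists v, side_universal s e a v).
Proof.
split=> [[h1 h2 h3 h4]|[h k]]; first by split=> -[] //.
by split; [exact: (h true)|exact: (k true)|exact: (h false)|exact: (k false)].
Qed.

Lemma tensor_unit_universal (X : mergeData) x (e : cell1 X) :
  is_tensor_unit x e -> tensor_universal e.
Proof.
case/tensor_unitP=> h k; apply/tensor_universalP.
by split=> s a ea; exists a; apply: k; rewrite ea h.
Qed.

Section SideUniversality.
Variable X : mergeBicat.
Implicit Types (p q r t : cell2 X) (a b c e : cell1 X) (A B C D G : seq (cell1 X)).

Lemma extremal_split s D : D <> [::] ->
  exists D1 d D2, D = D1 ++ d :: D2 /\ extremal s D1 D2.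
Proof.
case: s D => -[|d D] // _; first by exists [::], d, D.
by case/lastP: D => [|D d']; [exists [::], d, [::]
  |exists (d :: D), d', [::]; rewrite -cats1].
Qed.

Lemma pad_shift s e d D1 D2 : extremal s D1 D2 ->
  padl s e ++ (D1 ++ d :: D2) ++ padr s e = D1 ++ pad s e d ++ D2.
Proof. by case: s => /= ->; rewrite ?cats0 //= -catA. Qed.

Lemma path_pad p s e d D1 D2 : inp p = D1 ++ pad s e d ++ D2 ->
  endpt (~~ s) e = endpt s d.
Proof. by case: s => /= /path_pair. Qed.

(** A reading of in-universality without the reversal of 2-cells, with the planarity
    conditions reduced to one: e occupies side s of the inputs, so nothing can
    stand beyond c on that side of the outputs. *)
Lemma in_universalP t s e a c : inp t = pad s e a -> outp t = [:: c] ->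
  in_universal t s <->
  forall A B D q, D <> [::] -> extremal s A B ->
    inp q = padl s e ++ D ++ padr s e -> outp q = A ++ c :: B ->
    exists! r, [/\ inp r = D, outp r = A ++ a :: B & mrg (size A) s 1 r t = q].
Proof.
move=> ei eo; split.
  case=> D1 [a' [D2 [/= ]]]; rewrite ei => e1 e2 H A B D q D0 ext iq oq.
  have [E1 Ea E2] : [/\ D1 = padl s e, a' = a & D2 = padr s e].
    case: (s) {H} e1 e2 => /=; first by case: D1 => [|? [|? ?]] //= [-> -> ->].
    by case: D1 => //= -[-> ->].
  subst; have [||||r [[h1 h2 h3] u]] := H A B D q D0.
  - by case: (s) ext; auto.
  - by case: (s) ext; auto.
  - by rewrite eo.
  - by [].
  exists r; split=> // r' [h1' h2' h3']; apply: u; split=> //.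
move=> H; exists (padl s e), a, (padr s e); split=> //.
  by rewrite size_padl.
move=> A B D q D0 h1 h2 /=; rewrite eo => oq iq.
have ext : extremal s A B by case: (s) h1 h2 => /= [] [] // ? [].
have [r [[k1 k2 k3] u]] := H A B D q D0 ext iq oq.
exists r; split=> // r' [k1' k2' k3']; exact: u.
Qed.

End SideUniversality.

Section Representable.
Variables (X : mergeBicat) (V : unitors X).

(** By naturality, a factorisation of q through [lam s a] is a factorisation of q
    through the invertible [lam s d], where d is the entry next to the unit. *)
Lemma lam_universal s a : side_universal s (cu V (endpt s a)) a a.
Proof.
exists (lam V s a); have [e1 e2] := lam_bd V s a; split=> //.
  exact: inverse_out_universal (lam_inverse V s a).
apply/(in_universalP e1 e2) => A B D q D0 ext iq oq.
have [D1 [d [D2 [eD extD]]]] := extremal_split s D0.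
rewrite eD pad_shift // in iq.
have ed := path_pad iq; rewrite cu_endpt in ed; rewrite ed in iq.
have v := lam_inverse V s d.
have [f1 f2] := lam'_bd V s d.
have [i1 o1] : inp (mrg 0 (size D1) 2 (lam' V s d) q) = D1 ++ d :: D2 /\
    outp (mrg 0 (size D1) 2 (lam' V s d) q) = A ++ a :: B.
  have [] := @mrg_bd X [::] (pad s (cu V (endpt s d)) d) [::] D1 D2 0 (size D1) 2
    (lam' V s d) q; rewrite ?cats0 ?size_pad ?f1 ?f2 ?oq //.
  by case: s {ext extD v e1 e2 iq ed f1 f2}.
have key r : inp r = D1 ++ d :: D2 -> outp r = A ++ a :: B ->
    mrg (size A) s 1 r (lam V s a) = mrg 0 (size D1) 1 (lam V s d) r.
  by move=> ir or; apply: (lam_nat V ir or).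
exists (mrg 0 (size D1) 2 (lam' V s d) q); split.
  split; rewrite ?eD // key //.
  by apply: (inverse_inK v iq); rewrite ?size_pad.
move=> r [ir or]; rewrite key // -?eD // => <-.
by apply: (inverse_inK (inverse_sym v) (A := D1) (B := D2)); rewrite ?size_pad // ir.
Qed.

Lemma cu_tensor_unit x : is_tensor_unit x (cu V x).
Proof.
apply/tensor_unitP; split=> [s|s a <-]; first exact: cu_endpt.
exact: lam_universal.
Qed.

End Representable.

Lemma unitors_representable (X : mergeBicat) (V : unitors X) :
  zero_representable X.
Proof.
split=> [|x]; first exact: unitors_unital V.
split; exists (cu V x); first exact: cu_tensor_unit.
exact: (cu_tensor_unit (op_unitors V)).
Qed.

(** * From 0-representability to unitors *)

Lemma inverse_uniq (X : mergeBicat) (G D : seq (cell1 X)) (t t' t'' : cell2 X) :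
  inverse G D t t' -> inverse G D t t'' -> t' = t''.
Proof.
move=> v w; have [G0 D0] := inverse_neq0 v.
have [_ [e1 _] u _] := v; have [_ [f1 _] u' _] := w.
apply: (inverse_in_inj v (A := [::]) (B := [::]) (i := 0)); rewrite ?cats0 //.
exact: unit_uniq u u'.
Qed.

Ltac sizes :=
  rewrite ?(size_cat, size_pad, size_padl, size_padr, addn0, add0n, addnS, addSn) //=;
  rewrite ?(size_cat, size_pad, size_padl, size_padr, addn0, add0n, addnS, addSn) //=;
  try match goal with |- context [nat_of_bool ?s] => by clear; case: s end.

(** The triangle law is derived from what determines the unitors, so that it applies
    as well to their inverses in the reversed merge-bicategory.  [idp s a] is the
    unit on a pair, and merging with it along a is whiskering with e on side s. *)
Section Triangle.
Variable X : mergeBicat.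
Implicit Types (p q r t : cell2 X) (a b c : cell1 X) (A B C D G : seq (cell1 X)).
Variable e : cell0 X -> cell1 X.
Local Notation E s a := (e (endpt s a)).
Variable idp : bool -> cell1 X -> cell2 X.
Hypothesis idp_unit : forall s a, is_unit (pad s (E s a) a) (idp s a).
Variables phi phi' : cell0 X -> cell2 X.
Hypothesis phi_inverse : forall x, inverse [:: e x; e x] [:: e x] (phi x) (phi' x).
Variable lam : bool -> cell1 X -> cell2 X.
Hypothesis lam_bd : forall s a,
  inp (lam s a) = pad s (E s a) a /\ outp (lam s a) = [:: a].
Hypothesis lam_spec : forall (s : bool) a,
  mrg 0 s 1 (lam s a) (idp s a) = mrg 0 (~~ s) 1 (phi (endpt s a)) (idp s a).

(** Where a has its unit e beside it, the unitor that absorbs a new e next to a can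
    be traded for phi on the old e. *)
Lemma lam_phi (s : bool) a q A B : inp q = A ++ pad s (E s a) a ++ B ->
  mrg 0 (size A + s) 1 (lam s a) q =
  mrg 0 (size A + ~~ s) 1 (phi (endpt s a)) q.
Proof.
move=> eq; have u := idp_unit s a; have [u1 u2 _ _] := u.
have [l1 l2] := lam_bd s a; have [[f1 f2] _ _ _] := phi_inverse (endpt s a).
have P0 : pad s (E s a) a <> [::] by case: (s).
have E1 := unit_in u P0 eq erefl erefl.
transitivity (mrg 0 (size A) 2 (mrg 0 s 1 (lam s a) (idp s a)) q).
  rewrite -{1}E1 size_pad; apply/esym.
  apply: (@mrg_assoc X [::] [::] [:: a] [::] [::] (padl s (E s a)) (padr s (E s a))
    [::] (pad s (E s a) a) [::] A B);
   rewrite ?cats0 //; sizes.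
rewrite lam_spec -{2}E1 size_pad.
apply: (@mrg_assoc X [::] [::] [:: E s a] [::] [::] (padl (~~ s) a) (padr (~~ s) a)
    [::] (pad s (E s a) a) [::] A B);
   rewrite ?cats0 // -?pad_split //; sizes.
Qed.

(** Merge phi into the unit that stands between a and b.  By [lam_phi] this phi is
    l_b on the left-hand side of the equation and r_a on the right-hand side, and
    r_a, l_b can be merged in either order.  As phi is invertible, it cancels. *)
Lemma kock_triangle p A a b B : inp p = A ++ a :: b :: B ->
  mrg 0 (size A) 1 (lam false a) p = mrg 0 (size A).+1 1 (lam true b) p.
Proof.
move=> ip; have ab := path_pair ip.
have [a1 a2] := lam_bd false a; have [b1 b2] := lam_bd true b.
rewrite /pad /= -ab in a1 b1.
have p1 : inp (mrg 0 (size A) 1 (lam false a) p) =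
    A ++ [:: a; e (tgt a)] ++ b :: B.
  have [] := @mrg_bd X [::] [:: a] [::] A (b :: B) 0 (size A) 1 (lam false a) p;
    by rewrite // a1.
have q1 : inp (mrg 0 (size A).+1 1 (lam true b) p) =
    (A ++ [:: a]) ++ [:: e (tgt a); b] ++ B.
  have [] := @mrg_bd X [::] [:: b] [::] (A ++ [:: a]) B 0 (size A).+1 1
    (lam true b) p; by rewrite // ?b1 ?size_cat ?addn1 // ip -catA.
apply: (inverse_in_inj (phi_inverse (tgt a)) (A := A ++ [:: a]) (B := b :: B)
  (i := (size A).+1) (l := 1)) => //; rewrite ?p1 ?q1 -?catA ?size_cat ?addn1 //.
have := @lam_phi true b (mrg 0 (size A) 1 (lam false a) p) (A ++ [:: a]) B.
rewrite p1 /= -catA -ab /= => /(_ erefl).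
rewrite size_cat /= !addn1 addn0 => <-.
have := @lam_phi false a (mrg 0 (size A).+1 1 (lam true b) p) A (b :: B).
rewrite q1 /= -catA /= => /(_ erefl); rewrite addn0 addn1 => <-.
apply/esym; apply: (@mrg_swap X [::] [:: a] [:: b] [::] A [::] B); rewrite // ?a1; sizes.
Qed.

End Triangle.

Section Kock.
Variable X : mergeBicat.
Implicit Types (s : bool) (p q r t : cell2 X) (a b c d : cell1 X)
  (A B C D G : seq (cell1 X)).
Variable e : cell0 X -> cell1 X.
Local Notation E s a := (e (endpt s a)).
Hypothesis e_endpt : forall s x, endpt s (e x) = x.
Variable eps : cell1 X -> cell2 X.
Hypothesis eps_unit : forall a, is_unit [:: a] (eps a).
Variable idp : bool -> cell1 X -> cell2 X.
Hypothesis idp_unit : forall s a, is_unit (pad s (E s a) a) (idp s a).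
Variables phi phi' : cell0 X -> cell2 X.
Hypothesis phi_inverse : forall x, inverse [:: e x; e x] [:: e x] (phi x) (phi' x).
Hypothesis whisker_bij : forall s d A B D q, D <> [::] -> extremal s A B ->
  inp q = padl s (E s d) ++ D ++ padr s (E s d) ->
  outp q = A ++ pad s (E s d) d ++ B ->
  exists! r, [/\ inp r = D, outp r = A ++ d :: B &
                 mrg (size A) s 1 r (idp s d) = q].

Lemma whisker_bd s d A B r : extremal s A B -> outp r = A ++ d :: B ->
  inp (mrg (size A) s 1 r (idp s d)) = padl s (E s d) ++ inp r ++ padr s (E s d) /\
  outp (mrg (size A) s 1 r (idp s d)) = A ++ pad s (E s d) d ++ B.
Proof.
move=> ext or; have [u1 u2 _ _] := idp_unit s d.
have [] := @mrg_bd X A [:: d] B (padl s (E s d)) (padr s (E s d)) (size A) s 1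
   r (idp s d); rewrite ?u1 ?u2 ?size_padl //.
- exact: extremal_l ext.
- exact: extremal_r ext.
Qed.

Lemma whisker_inj s d A B r r' : extremal s A B -> inp r = inp r' ->
  outp r = A ++ d :: B -> outp r' = A ++ d :: B ->
  mrg (size A) s 1 r (idp s d) = mrg (size A) s 1 r' (idp s d) -> r = r'.
Proof.
move=> ext ei eo eo' E0; have [w1 w2] := whisker_bd ext eo.
have [r0 [_ U]] := whisker_bij (@inp_neq0 _ (maxioms X) r) ext w1 w2.
by rewrite -(U r) // (U r').
Qed.

Lemma endpt_par s p A a B C b D : inp p = A ++ a :: B -> outp p = C ++ b :: D ->
  extremal s A B -> extremal s C D -> endpt s a = endpt s b.
Proof.
move=> ip op; have [x [y []]] := parallel (maxioms X) p; rewrite ip op.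
case: s => /= h k eA eB; move: h k; rewrite eA eB /=; first by case=> -> _ [-> _].
by move=> /is_path_cat [? [_ [_ <-]]] /is_path_cat [? [_ [_ <-]]].
Qed.

(** Both sides are the pasting of p between the unit on its padded input and the
    unit on its padded output. *)
Lemma whisker_swap s p A a B C b D :
  inp p = A ++ a :: B -> outp p = C ++ b :: D ->
  extremal s A B -> extremal s C D ->
  mrg (size C) s 1 p (idp s b) = mrg s (size A) 1 (idp s a) p.
Proof.
move=> ip op eA eC; have [w1 w2] := whisker_bd eC op.
have ab := endpt_par ip op eA eC.
have [u1 u2 _ _] := idp_unit s a; have [v1 v2 _ _] := idp_unit s b.
rewrite -ab in v1 v2 w1 w2.
rewrite ip pad_shift // in w1.
have P0 c d : pad s c d <> [::] by case: (s).
rewrite -[LHS](unit_in (idp_unit s a) _ w1 erefl erefl) //.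
have [w3 w4] : inp (mrg s (size A) 1 (idp s a) p) = A ++ pad s (E s a) a ++ B /\
    outp (mrg s (size A) 1 (idp s a) p) = C ++ pad s (E s a) b ++ D.
  have [] := @mrg_bd X (padl s (E s a)) [:: a] (padr s (E s a)) A B s (size A) 1
    (idp s a) p; rewrite ?u1 ?u2 ?size_padl ?op -?pad_shift //.
  - by apply/or_comm/(extremal_l _ eA).
  - by apply/or_comm/(extremal_r _ eA).
rewrite ab in w4; rewrite -[RHS](unit_out (idp_unit s b) _ w4 erefl erefl) //.
apply/esym; apply: (@mrg_assoc X [::] (padl s (E s a)) [:: a] (padr s (E s a)) [::]
   A B C [:: b] D [::] [::]); rewrite ?cats0 //; try by sizes.
- exact: extremal_l eC.
- exact: extremal_r eC.
- by apply/or_comm/(extremal_l _ eA).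
- by apply/or_comm/(extremal_r _ eA).
Qed.

(** Whiskering is onto, so phi beside a is the whiskering of some l. *)
Lemma lam_exists s a : exists l, [/\ inp l = pad s (E s a) a, outp l = [:: a] &
  mrg 0 s 1 l (idp s a) = mrg 0 (~~ s) 1 (phi (endpt s a)) (idp s a)].
Proof.
set x := endpt s a; have [u1 u2 _ _] := idp_unit s a.
have [[f1 f2] _ _ _] := phi_inverse x.
have [h1 h2] : inp (mrg 0 (~~ s) 1 (phi x) (idp s a)) =
    padl s (e x) ++ pad s (e x) a ++ padr s (e x) /\
    outp (mrg 0 (~~ s) 1 (phi x) (idp s a)) = pad s (e x) a.
  have [] := @mrg_bd X [::] [:: e x] [::] (padl (~~ s) a) (padr (~~ s) a) 0 (~~ s) 1
    (phi x) (idp s a); rewrite ?f1 ?u1 -?pad_split ?u2 ?size_padl ?cats0 //.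
  by move=> -> ->; rewrite -/x; case: (s).
have [||||l [[l1 l2 l3] _]] := @whisker_bij s a [::] [::] (pad s (e x) a)
  (mrg 0 (~~ s) 1 (phi x) (idp s a)) => //.
- by case: (s).
- by case: (s).
- by rewrite h2 cats0.
by exists l.
Qed.

Lemma lam'_exists s a : exists k, [/\ inp k = [:: a], outp k = pad s (E s a) a &
  mrg (~~ s) s 1 k (idp s (E s a)) = mrg (~~ s) 0 1 (idp s a) (phi' (endpt s a))].
Proof.
set x := endpt s a; have [u1 u2 _ _] := idp_unit s a.
have [_ [f1 f2] _ _] := phi_inverse x.
have [h1 h2] : inp (mrg (~~ s) 0 1 (idp s a) (phi' x)) = pad s (e x) a /\
    outp (mrg (~~ s) 0 1 (idp s a) (phi' x)) =
    padl (~~ s) a ++ pad s (e x) (e x) ++ padr (~~ s) a.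
  have [] := @mrg_bd X (padl (~~ s) a) [:: e x] (padr (~~ s) a) [::] [::] (~~ s) 0 1
    (idp s a) (phi' x); rewrite ?f1 ?f2 ?u1 ?u2 -?pad_split ?size_padl ?cats0 //.
  by move=> -> ->; rewrite -/x; case: (s).
have [||||k [[k1 k2 k3] _]] := @whisker_bij s (e x) (padl (~~ s) a) (padr (~~ s) a) [:: a]
  (mrg (~~ s) 0 1 (idp s a) (phi' x)) => //.
- by case: (s).
- by rewrite h1 e_endpt.
- by rewrite h2 e_endpt.
exists k; split=> //; first by rewrite k2 pad_split.
by rewrite -k3 size_padl.
Qed.

Variables lam lam' : bool -> cell1 X -> cell2 X.
Hypothesis lam_bd : forall s a,
  inp (lam s a) = pad s (E s a) a /\ outp (lam s a) = [:: a].
Hypothesis lam_spec : forall s a,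
  mrg 0 s 1 (lam s a) (idp s a) = mrg 0 (~~ s) 1 (phi (endpt s a)) (idp s a).
Hypothesis lam'_bd : forall s a,
  inp (lam' s a) = [:: a] /\ outp (lam' s a) = pad s (E s a) a.
Hypothesis lam'_spec : forall s a,
  mrg (~~ s) s 1 (lam' s a) (idp s (E s a)) =
  mrg (~~ s) 0 1 (idp s a) (phi' (endpt s a)).

(** After whiskering, both sides become p whiskered, with phi merged into the
    unit. *)
Lemma kock_nat s p A a B C b D : inp p = A ++ a :: B -> outp p = C ++ b :: D ->
  extremal s A B -> extremal s C D ->
  mrg (size C) s 1 p (lam s b) = mrg 0 (size A) 1 (lam s a) p.
Proof.
move=> ip op eA eC; have ab := endpt_par ip op eA eC.
have [a1 a2] := lam_bd s a; have [b1 b2] := lam_bd s b.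
have [u1 u2 _ _] := idp_unit s a; have [v1 v2 _ _] := idp_unit s b.
have [[f1 f2] _ _ _] := phi_inverse (endpt s b).
have [l1 l2] : inp (mrg (size C) s 1 p (lam s b)) = padl s (E s b) ++ inp p ++ padr s (E s b)
   /\ outp (mrg (size C) s 1 p (lam s b)) = C ++ b :: D.
  have [] := @mrg_bd X C [:: b] D (padl s (E s b)) (padr s (E s b)) (size C) s 1
    p (lam s b); rewrite ?b1 ?b2 ?size_padl //.
  - exact: extremal_l eC.
  - exact: extremal_r eC.
have [r1 r2] : inp (mrg 0 (size A) 1 (lam s a) p) = A ++ pad s (E s a) a ++ B
   /\ outp (mrg 0 (size A) 1 (lam s a) p) = C ++ b :: D.
  have [] := @mrg_bd X [::] [:: a] [::] A B 0 (size A) 1 (lam s a) p;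
    by rewrite ?cats0 // a1 op.
apply: (whisker_inj eC _ l2 r2); first by rewrite l1 r1 ip pad_shift // ab.
transitivity (mrg 0 (size A + ~~ s) 1 (phi (endpt s b)) (mrg (size C) s 1 p (idp s b))).
  transitivity (mrg (size C) (s + s) 1 p (mrg 0 s 1 (lam s b) (idp s b))).
    apply: (@mrg_assoc X C [::] [:: b] [::] D (padl s (E s b)) (padr s (E s b)) [::] [:: b]
      [::] (padl s (E s b)) (padr s (E s b))); rewrite ?cats0 //; try by sizes.
    - exact: extremal_l eC.
    - exact: extremal_r eC.
    - exact: extremal_l eC.
    - exact: extremal_r eC.
  rewrite lam_spec.
  case: (s) eA eC v1 f1 f2 => /= eA eC v1 f1 f2.
    rewrite eA eC in ip op *.
    by apply/esym; apply: (@mrg_swap X [::] [:: E true b] [:: b] D [::] [::] [::]);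
      rewrite // ?f1 ?f2.
  rewrite eA eC in ip op *.
  by apply: (@mrg_swap X C [:: b] [:: E false b] [::] [::] [::] [::]); rewrite // ?ip; sizes.
rewrite (whisker_swap ip op eA eC) -ab.
transitivity (mrg s (size A) 1 (mrg 0 (~~ s) 1 (phi (endpt s a)) (idp s a)) p).
  apply/esym; apply: (@mrg_assoc X [::] [::] [:: E s a] [::] [::] (padl (~~ s) a) (padr (~~ s) a)
    (padl s (E s a)) [:: a] (padr s (E s a)) A B); rewrite ?cats0 -?pad_split //; try by sizes.
  - by rewrite ab.
  - by apply/or_comm/(extremal_l _ eA).
  - by apply/or_comm/(extremal_r _ eA).
rewrite -lam_spec.
transitivity (mrg 0 (s + size A) 1 (lam s a) (mrg (size C) s 1 p (idp s b))).
  rewrite (whisker_swap ip op eA eC).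
  apply: (@mrg_assoc X [::] [::] [:: a] [::] [::] (padl s (E s a)) (padr s (E s a))
    (padl s (E s a)) [:: a] (padr s (E s a)) A B); rewrite ?cats0 //; try by sizes.
  - by apply/or_comm/(extremal_l _ eA).
  - by apply/or_comm/(extremal_r _ eA).
  - by sizes; rewrite addnC.
apply/esym; apply: (@mrg_assoc X [::] [::] [:: a] [::] [::] A B C [:: b] D
  (padl s (E s b)) (padr s (E s b))); rewrite ?cats0 //; try by sizes.
- exact: extremal_l eC.
- exact: extremal_r eC.
Qed.

(** On the pair (e, e) the triangle law says that phi can be moved from one input to
    the other, so phi satisfies the equation that determines [lam s (e x)]. *)
Lemma kock_phi s x : lam s (e x) = phi x.
Proof.
have [[f1 f2] _ _ _] := phi_inverse x.
have swap_phi s' : mrg 0 0 1 (phi x) (idp s' (e x)) = mrg 0 1 1 (phi x) (idp s' (e x)).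
  have same s1 s2 : idp s1 (e x) = idp s2 (e x).
    have h s3 : is_unit [:: e x; e x] (idp s3 (e x)).
      by have := idp_unit s3 (e x); rewrite e_endpt; case: (s3).
    exact: unit_uniq (h s1) (h s2).
  have [u1 _ _ _] := idp_unit true (e x); rewrite e_endpt in u1.
  have h := @kock_triangle X e idp idp_unit phi phi' phi_inverse lam lam_bd
    lam_spec (idp true (e x)) [::] (e x) (e x) [::] u1.
  have := lam_spec true (e x); have := lam_spec false (e x).
  by rewrite !e_endpt (same false true) (same s' true) /= -h => -> ->.
have [l1 l2] := lam_bd s (e x); rewrite e_endpt in l1.
apply: (@whisker_inj s (e x) [::] [::]) => //; first by case: (s).
  by rewrite l1 f1; case: (s).
rewrite lam_spec e_endpt.
by case: (s); rewrite /= swap_phi.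
Qed.

Lemma kock_lam'_phi s a :
  mrg (~~ s) s 1 (lam' s a) (phi (endpt s a)) = idp s a.
Proof.
have [k1 k2] := lam'_bd s a; have [u1 u2 _ _] := idp_unit s a.
have v := phi_inverse (endpt s a); have [[f1 f2] _ _ _] := v.
have [w1 w2 _ _] := idp_unit s (E s a); rewrite e_endpt in w1 w2.
have iphi : inp (phi (endpt s a)) = [::] ++ pad s (E s a) (E s a) ++ [::].
  by rewrite f1; case: (s).
have wu := idp_unit s (E s a); rewrite e_endpt in wu.
rewrite -{1}(unit_in wu _ iphi erefl erefl); last exact: pad_neq0.
transitivity (mrg (~~ s) 0 2 (mrg (~~ s) s 1 (lam' s a) (idp s (E s a)))
    (phi (endpt s a))).
  rewrite size_pad.
  apply/esym; apply: (@mrg_assoc X (padl (~~ s) a) [::] [:: E s a] [::] (padr (~~ s) a)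
    (padl s (E s a)) (padr s (E s a)) [::] (pad s (E s a) (E s a)) [::] [::] [::]);
    rewrite ?cats0 -?pad_split //; try (by sizes); try exact: pad_neq0.
  - by rewrite f1; case: (s).
  - by case: (s); auto.
  - by case: (s); auto.
rewrite lam'_spec.
apply: (inverse_outK (inverse_sym v) (A := padl (~~ s) a) (B := padr (~~ s) a) (l := 1)) => //.
  by rewrite u2 pad_split.
by rewrite size_padl.
Qed.

(** By naturality along [lam' s a], the composite on the pair is [lam' s a] ; phi, a
    unit by construction.  The composite on a is a unit after whiskering. *)
Lemma kock_inverse s a : inverse (pad s (E s a) a) [:: a] (lam s a) (lam' s a).
Proof.
have [l1 l2] := lam_bd s a; have [k1 k2] := lam'_bd s a.
have [u1 u2 _ _] := idp_unit s a; have [[f1 f2] _ _ _] := phi_inverse (endpt s a).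
split=> //.
  have k3 : outp (lam' s a) = padl (~~ s) a ++ E s a :: padr (~~ s) a.
    by rewrite k2 pad_split.
  have := @kock_nat s (lam' s a) [::] a [::] _ _ _ k1 k3.
  rewrite kock_phi size_padl kock_lam'_phi /= => <- //; by case: (s).
rewrite size_pad.
have [h1 h2] : inp (mrg 0 0 2 (lam' s a) (lam s a)) = [:: a] /\
    outp (mrg 0 0 2 (lam' s a) (lam s a)) = [:: a].
  by have [] := @mrg_bd X [::] (pad s (E s a) a) [::] [::] [::] 0 0 2 (lam' s a) (lam s a);
    rewrite ?cats0 ?size_pad ?k1 ?k2 ?l1 ?l2 ?cats0 //; try exact: pad_neq0.
suff -> : mrg 0 0 2 (lam' s a) (lam s a) = eps a by [].
have [e1 e2 _ _] := eps_unit a.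
apply: (@whisker_inj s a [::] [::]); rewrite ?h1 ?h2 ?e1 ?e2 //.
  by case: (s).
rewrite [RHS](_ : _ = idp s a); last first.
  by apply: (@unit_in X [:: a] _ (padl s (E s a)) (padr s (E s a)));
    rewrite ?size_padl.
transitivity (mrg 0 s 2 (lam' s a) (mrg 0 s 1 (lam s a) (idp s a))).
  apply: (@mrg_assoc X [::] [::] (pad s (E s a) a) [::] [::] [::] [::] [::] [:: a] [::]
    (padl s (E s a)) (padr s (E s a))); rewrite ?cats0 //; try (by sizes);
  exact: pad_neq0.
rewrite lam_spec.
transitivity (mrg 0 0 2 (mrg (~~ s) s 1 (lam' s a) (phi (endpt s a))) (idp s a)).
  apply/esym; apply: (@mrg_assoc X [::] (padl (~~ s) a) [:: E s a] (padr (~~ s) a) [::]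
    (padl s (E s a)) (padr s (E s a)) [::] [:: E s a] [::] [::] [::]);
  rewrite ?cats0 -?pad_split //; try (by sizes).
  - by rewrite f1; case: (s).
  - by case: (s); auto.
  - by case: (s); auto.
rewrite kock_lam'_phi; apply: (unit_in (idp_unit s a) (A := [::]) (B := [::]));
  rewrite ?cats0 ?size_pad //; exact: pad_neq0.
Qed.

Lemma kock_phi' s x : lam' s (e x) = phi' x.
Proof.
have v := kock_inverse s (e x); rewrite kock_phi e_endpt in v.
apply: (inverse_uniq (G := [:: e x; e x]) _ (phi_inverse x)).
by case: (s) v.
Qed.

(** Both sides agree with p after merging with the invertible [lam s b]. *)
Lemma kock_nat' s p A a B C b D : inp p = A ++ a :: B -> outp p = C ++ b :: D ->
  extremal s A B -> extremal s C D ->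
  mrg (size C) 0 1 p (lam' s b) = mrg s (size A) 1 (lam' s a) p.
Proof.
move=> ip op eA eC; have ab := endpt_par ip op eA eC.
have [a1 a2] := lam'_bd s a; have [b1 b2] := lam'_bd s b.
have [c1 c2] := lam_bd s b.
have v := kock_inverse s a; have w := kock_inverse s b.
have e1 : outp (mrg s (size A) 1 (lam' s a) p) = C ++ pad s (E s b) b ++ D.
  have [] := @mrg_bd X (padl s (E s a)) [:: a] (padr s (E s a)) A B s (size A) 1
    (lam' s a) p; rewrite ?size_padl //.
  - by apply/or_comm/(extremal_l _ eA).
  - by apply/or_comm/(extremal_r _ eA).
  - by rewrite op pad_shift // ab.
have e2 : outp (mrg (size C) 0 1 p (lam' s b)) = C ++ pad s (E s b) b ++ D.
  by have [] := @mrg_bd X C [:: b] D [::] [::] (size C) 0 1 p (lam' s b);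
    rewrite // b2.
apply: (inverse_out_inj w e2 e1 (j := size C) (l := 2)); rewrite ?size_pad //.
rewrite (inverse_outK (inverse_sym w) (A := C) (B := D)) ?size_pad //.
transitivity (mrg 0 (size A) 2 (lam' s a) (mrg (size C) s 1 p (lam s b))).
  rewrite (kock_nat ip op eA eC).
  by rewrite (inverse_inK (inverse_sym v) (A := A) (B := B)) ?size_pad.
apply/esym; apply: (@mrg_assoc X [::] (padl s (E s a)) [:: a] (padr s (E s a)) [::]
   A B C [:: b] D [::] [::]); rewrite ?cats0 ?a2 ?ab //; try by sizes.
- exact: extremal_l eC.
- exact: extremal_r eC.
- by apply/or_comm/(extremal_l _ eA).
- by apply/or_comm/(extremal_r _ eA).
Qed.

End Kock.

Section Representable.
Variable X : mergeBicat.
Implicit Types (s : bool) (a d e : cell1 X) (A B D : seq (cell1 X)) (q r t : cell2 X).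

Lemma composable_pad s e a : endpt (~~ s) e = endpt s a ->
  composable (pad s e a).
Proof.
case: s => /= h; first by exists (src e), (tgt a).
by exists (src a), (tgt e).
Qed.

(** The 2-cell t that makes e a tensor unit at d is invertible, so whiskering with e
    is bijective exactly as merging with t is. *)
Lemma universal_whisker s e d u w : is_unit (pad s e d) u -> is_unit [:: d] w ->
  side_universal s e d d ->
  forall A B D q, D <> [::] -> extremal s A B ->
  inp q = padl s e ++ D ++ padr s e -> outp q = A ++ pad s e d ++ B ->
  exists! r, [/\ inp r = D, outp r = A ++ d :: B & mrg (size A) s 1 r u = q].
Proof.
move=> hu hw [t [t1 t2 tout /(in_universalP t1 t2) tin]] A B D q D0 ext iq oq.
have [t' v] := out_universal_inverse t1 t2 hu hw tout.
have [u1 u2 _ _] := hu.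
have P0 : pad s e d <> [::] by case: (s).
have [i1 o1] : inp (mrg (size A) 0 2 q t) = padl s e ++ D ++ padr s e /\
    outp (mrg (size A) 0 2 q t) = A ++ d :: B.
  have [] := @mrg_bd X A (pad s e d) B [::] [::] (size A) 0 2 q t;
    by rewrite ?cats0 ?size_pad ?iq ?t1 ?t2 // => ->; case: (s).
have key r : inp r = D -> outp r = A ++ d :: B ->
    mrg (size A) s 1 r t = mrg (size A) 0 2 (mrg (size A) s 1 r u) t /\
    outp (mrg (size A) s 1 r u) = A ++ pad s e d ++ B.
  move=> ir or; split.
    have t1' : inp t = [::] ++ pad s e d ++ [::] by rewrite cats0.
    rewrite -{1}(unit_in hu P0 t1' erefl erefl) size_pad; apply/esym.
    apply: (@mrg_assoc X A [::] [:: d] [::] B (padl s e) (padr s e) [::] (pad s e d)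
      [::] [::] [::]); rewrite ?cats0 //; try by sizes.
    - exact: extremal_l ext.
    - exact: extremal_r ext.
  have [] := @mrg_bd X A [:: d] B (padl s e) (padr s e) (size A) s 1 r u;
    rewrite ?u1 ?u2 ?size_padl //.
  - exact: extremal_l ext.
  - exact: extremal_r ext.
have [r [[r1 r2 r3] U]] := tin A B D _ D0 ext i1 o1.
exists r; split=> [|r' [r1' r2' r3']].
  split=> //; have [k1 k2] := key r r1 r2.
  by apply: (inverse_out_inj v k2 oq (j := size A) (l := 2));
    rewrite ?size_pad // -k1.
by apply: U; split=> //; have [-> _] := key r' r1' r2'; rewrite r3'.
Qed.

Lemma representable_unitors : zero_representable X -> inhabited (unitors X).
Proof.
case=> un rep.
have /choice [e he] : forall x, exists e, is_tensor_unit x e by move=> x; case: (rep x).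
have e_endpt s x : endpt s (e x) = x by case/tensor_unitP: (he x).
have e_univ s a : side_universal s (e (endpt s a)) a a.
  by case/tensor_unitP: (he (endpt s a)) => _; apply.
have /choice [eps eps_unit] : forall a : cell1 X, exists u, is_unit [:: a] u.
  by move=> a; apply: un => //; exists (src a), (tgt a).
have pad0 s (a b : cell1 X) : pad s a b <> [::] by case: s.
have /choice [idp2 hidp] : forall sa : bool * cell1 X, exists u,
    is_unit (pad sa.1 (e (endpt sa.1 sa.2)) sa.2) u.
  by case=> s a /=; apply: un => //; apply: composable_pad.
pose idp s a := idp2 (s, a).
have idp_unit s a : is_unit (pad s (e (endpt s a)) a) (idp s a) := hidp (s, a).
have /choice [pp hpp] : forall x, exists pp : cell2 X * cell2 X,
    inverse [:: e x; e x] [:: e x] pp.1 pp.2.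
  move=> x; have := e_univ true (e x); rewrite e_endpt => -[t [t1 t2 t3 _]].
  have hu := idp_unit true (e x); rewrite e_endpt in hu.
  have [t' v] := out_universal_inverse t1 t2 hu (eps_unit (e x)) t3.
  by exists (t, t').
have whisker s d := universal_whisker (idp_unit s d) (eps_unit d) (e_univ s d).
pose phi x := (pp x).1; pose phi' x := (pp x).2.
have phi_inv x : inverse [:: e x; e x] [:: e x] (phi x) (phi' x) := hpp x.
have /choice [lam2 hlam] := fun sa : bool * cell1 X =>
  lam_exists idp_unit phi_inv whisker sa.1 sa.2.
have /choice [lam2' hlam'] := fun sa : bool * cell1 X =>
  lam'_exists e_endpt idp_unit phi_inv whisker sa.1 sa.2.
pose lam s a := lam2 (s, a); pose lam' s a := lam2' (s, a).
have lam_bd s a : inp (lam s a) = pad s (e (endpt s a)) a /\ outp (lam s a) = [:: a].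
  by case: (hlam (s, a)).
have lam'_bd s a : inp (lam' s a) = [:: a] /\ outp (lam' s a) = pad s (e (endpt s a)) a.
  by case: (hlam' (s, a)).
have lam_spec s a : mrg 0 s 1 (lam s a) (idp s a) =
    mrg 0 (~~ s) 1 (phi (endpt s a)) (idp s a) by case: (hlam (s, a)).
have lam'_spec s a : mrg (~~ s) s 1 (lam' s a) (idp s (e (endpt s a))) =
  mrg (~~ s) 0 1 (idp s a) (phi' (endpt s a)) by case: (hlam' (s, a)).
constructor; apply: (@Unitors X e eps lam lam') => //.
- by move=> x; rewrite !(kock_phi e_endpt idp_unit phi_inv whisker lam_bd lam_spec).
- by move=> x; rewrite !(kock_phi' e_endpt eps_unit idp_unit phi_inv whisker lam_bd
    lam_spec lam'_bd lam'_spec).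
- move=> s a; have [_ _ _ u] := kock_inverse e_endpt eps_unit idp_unit phi_inv whisker
    lam_bd lam_spec lam'_bd lam'_spec s a.
  by rewrite size_pad in u; apply: unit_uniq u (eps_unit a).
- exact (kock_nat idp_unit phi_inv whisker lam_bd lam_spec).
- exact (kock_nat' e_endpt eps_unit idp_unit phi_inv whisker lam_bd lam_spec
    lam'_bd lam'_spec).
- exact (kock_triangle idp_unit phi_inv lam_bd lam_spec).
(* The last law is the triangle law of the reversed merge-bicategory, where phi'
   plays the part of phi. *)
have op s a : @is_unit (op_mergeBicat X) (pad s (e (endpt s a)) a) (idp s a).
  exact/op_unit/idp_unit.
apply: (@kock_triangle (op_mergeBicat X) e idp op phi' phi _ lam').
- by move=> x; have [[? ?] [? ?] ? ?] := phi_inv x; split=> //; apply: op_unit.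
- by move=> s a; have [? ?] := lam'_bd s a.
move=> s a /=; have [k1 k2] := lam'_bd s a.
have k3 : outp (lam' s a) = padl (~~ s) a ++ e (endpt s a) :: padr (~~ s) a.
  by rewrite k2 pad_split.
rewrite -lam'_spec.
have := @whisker_swap X e idp idp_unit s (lam' s a) [::] a [::] _ _ _ k1 k3.
by rewrite size_padl /= => <- //; case: (s).
Qed.

End Representable.

(** * Inflation as the free extension by unitors *)

Lemma onth_size_cat (T : Type) (A : seq T) a B : onth (A ++ a :: B) (size A) = Some a.
Proof. by elim: A. Qed.

Section InflateUnitors.
Variable X : mergeBicat.

Definition inflate_unitors : unitors (inflate X).
Proof.
refine (@Unitors (inflate X) (@iunit X) (@ieps X)
  (fun s a => if s then il a else ir a) (fun s a => if s then ils a else irs a)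
  _ _ _ _ _ _ _ _ _ _ _).
- by case.
- move=> a; apply: unitI => [||A B p e|A B p e]; rewrite ?[LHS]iinp_cls ?[LHS]ioutp_cls //.
    by apply: ieps_outp; rewrite e onth_size_cat.
  by apply: ieps_inp; rewrite e onth_size_cat.
- by case=> a; split; rewrite ?[LHS]iinp_cls ?[LHS]ioutp_cls.
- by case=> a; split; rewrite ?[LHS]iinp_cls ?[LHS]ioutp_cls.
- exact (@il_ir X).
- exact (@ils_irs X).
- by case=> a; [apply: ils_il|apply: irs_ir].
- case=> p A a B C b D ip op /= eA eC.
    rewrite eA eC in ip op *; exact: il_nat ip op.
  rewrite eA eC in ip op *; rewrite cats1 in ip; rewrite cats1 in op.
  exact: ir_nat.
- case=> p A a B C b D ip op /= eA eC.
    rewrite eA eC in ip op *; exact/esym/(ils_nat ip op).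
  rewrite eA eC in ip op *; rewrite cats1 in ip; rewrite cats1 in op.
  exact/esym/irs_nat.
- move=> p A a b B ip; apply: ir_il; rewrite ip ?onth_size_cat //.
  by rewrite -cat_rcons -(size_rcons A a) onth_size_cat.
- move=> p A a b B op; apply: irs_ils; rewrite op ?onth_size_cat //.
  by rewrite -cat_rcons -(size_rcons A a) onth_size_cat.
Defined.

End InflateUnitors.

Record unitors_mor (Y X : mergeBicat) (U : unitors Y) (V : unitors X)
    (f : morphism Y X) : Prop := {
  um_cu : forall y, mor1 f (cu U y) = cu V (mor0 f y);
  um_eps : forall a, mor2 f (eps U a) = eps V (mor1 f a);
  um_lam : forall s a, mor2 f (lam U s a) = lam V s (mor1 f a);
  um_lam' : forall s a, mor2 f (lam' U s a) = lam' V s (mor1 f a) }.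

Section Fold.
Variables (X Z : mergeBicat) (V : unitors Z) (f : morphism X Z).

Definition fold1 (a : icell1 X) : cell1 Z :=
  match a with iold a => mor1 f a | iunit x => cu V (mor0 f x) end.

Fixpoint fold_term (t : iterm X) : cell2 Z :=
  match t with
  | tcell p => mor2 f p
  | teps a => eps V (fold1 a)
  | tl a => lam V true (fold1 a)
  | tls a => lam' V true (fold1 a)
  | tr a => lam V false (fold1 a)
  | trs a => lam' V false (fold1 a)
  | tmrg j i l t s => mrg j i l (fold_term t) (fold_term s)
  end.

Lemma fold1_endpt s a : endpt s (fold1 a) = mor0 f (if s then isrc a else itgt a).
Proof.
case: a => [a|x]; last by rewrite [LHS]cu_endpt; case: s.
by case: s; [apply: (mor_src (moraxioms f))|apply: (mor_tgt (moraxioms f))].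
Qed.

Lemma fold_pad s a :
  pad s (cu V (endpt s (fold1 a))) (fold1 a) =
  map fold1 (pad s (iunit (if s then isrc a else itgt a)) a).
Proof. by rewrite fold1_endpt; case: s. Qed.

Lemma fold_bd t : twf t -> inp (fold_term t) = map fold1 (tinp t) /\
  outp (fold_term t) = map fold1 (toutp t).
Proof.
elim: t => [p _|a _|a _|a _|a _|a _|j i l t IHt s IHs [wt ws m]].
- rewrite [LHS](mor_inp (moraxioms f)) [X in _ /\ X = _](mor_outp (moraxioms f)).
  by rewrite /= -!map_comp.
- by have [] := eps_unit V (fold1 a).
- by have [] := lam_bd V true (fold1 a); rewrite fold_pad.
- by have [] := lam'_bd V true (fold1 a); rewrite fold_pad.
- by have [] := lam_bd V false (fold1 a); rewrite fold_pad.
- by have [] := lam'_bd V false (fold1 a); rewrite fold_pad.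
have [e1 f1] := IHt wt; have [e2 f2] := IHs ws.
have m' : mergeable j i l (outp (fold_term t)) (inp (fold_term s)).
  by rewrite f1 e2; apply: mergeable_map.
rewrite [fold_term _]/= (inp_mrg (maxioms Z) m') (outp_mrg (maxioms Z) m').
by rewrite e1 e2 f1 f2 /= !splice_map.
Qed.

Lemma fold_eval (c : 'I_3 -> cell2 (tdata X)) T : (forall k, twf (c k)) ->
  evaluable c T ->
  evaluable (fun k => fold_term (c k)) T /\
  fold_term (eval c T) = eval (fun k => fold_term (c k)) T.
Proof.
move=> w; elim: T => //= j i l T1 IH1 T2 IH2 [v1 v2 m].
have [u1 e1] := IH1 v1; have [u2 e2] := IH2 v2.
rewrite -e1 -e2; split=> //; split=> //.
have [_ ->] := fold_bd (twf_eval w v1); have [-> _] := fold_bd (twf_eval w v2).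
exact: mergeable_map.
Qed.

Lemma fold_onth s i a : onth s i = Some a -> exists A B,
  [/\ map fold1 s = A ++ fold1 a :: B & size A = i].
Proof.
move=> h; have [A [B [-> <-]]] := onth_split h; exists (map fold1 A), (map fold1 B).
by rewrite map_cat size_map.
Qed.

Lemma fold_onth2 s i a b : onth s i = Some a -> onth s i.+1 = Some b ->
  exists A B, [/\ map fold1 s = A ++ fold1 a :: fold1 b :: B & size A = i].
Proof.
move=> h; have [A [B [-> <-]]] := onth_split h.
case: B => [|b' B].
  rewrite cats1 -(size_rcons A a).
  by rewrite (_ : onth _ _ = None) //; elim: (rcons A a).
rewrite -cat_rcons -(size_rcons A a) onth_size_cat => -[<-].
by exists (map fold1 A), (map fold1 B); rewrite cat_rcons map_cat size_map.
Qed.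

(** The relations that generate the congruence are the coherence of merges and the
    laws of unitors, both of which hold in Z. *)
Lemma fold_cong t u : tcong t u -> twf t -> fold_term t = fold_term u.
Proof.
elim=> {t u}.
- by [].
- by move=> t u h IH w; rewrite IH //; apply: tcong_twf (tc_sym h) w.
- by move=> t u v h IH _ IH' w; rewrite IH // IH' //; apply: tcong_twf h w.
- by move=> j i l t t' s s' [wt ws _] _ IHt _ IHs _ /=; rewrite IHt // IHs.
- move=> c T T' w [p v] [p' v'] d _.
  have [u ->] := fold_eval w v; have [u' ->] := fold_eval w v'.
  apply: (mrg_coherent (maxioms Z)) => //.
  apply: same_diagram_size d => k; have [h1 h2] := fold_bd (w k).
    by rewrite h1 size_map.
  by rewrite h2 size_map.
- by move=> x _; apply: lam_cu.
- by move=> x _; apply: lam'_cu.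
- by move=> j i l p q m _; rewrite [RHS](mor_mrg (moraxioms f)).
- move=> p i a w h _; have [A [B [e <-]]] := fold_onth h.
  have [_ op] := fold_bd w; rewrite e in op.
  by apply: (unit_out (eps_unit V _) _ op).
- move=> p i a w h _; have [A [B [e <-]]] := fold_onth h.
  have [ip _] := fold_bd w; rewrite e in ip.
  by apply: (unit_in (eps_unit V _) _ ip).
- by move=> a _; apply: lam'K.
- by move=> a _; apply: lam'K.
- move=> p a G b D w e g _; have [h1 h2] := fold_bd w.
  rewrite e in h1; rewrite g in h2.
  by apply: (@lam_nat _ V true _ [::] _ _ [::] _ _ h1 h2).
- move=> p a G b D w e g _; have [h1 h2] := fold_bd w.
  rewrite e in h1; rewrite g in h2; apply/esym.
  by apply: (@lam'_nat _ V true _ [::] _ _ [::] _ _ h1 h2).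
- move=> p a G b D w e g _; have [h1 h2] := fold_bd w.
  rewrite e -cats1 map_cat in h1; rewrite g -cats1 map_cat in h2.
  rewrite -(size_map fold1 G) -(size_map fold1 D).
  by apply: (lam_nat V h1 h2 (s := false)).
- move=> p a G b D w e g _; have [h1 h2] := fold_bd w.
  rewrite e -cats1 map_cat in h1; rewrite g -cats1 map_cat in h2.
  rewrite -(size_map fold1 G) -(size_map fold1 D); apply/esym.
  by apply: (lam'_nat V h1 h2 (s := false)).
- move=> p j a b w e g _; have [A [B [h <-]]] := fold_onth2 e g.
  have [ip _] := fold_bd w; rewrite h in ip.
  exact: (triangle V ip).
- move=> p i a b w e g _; have [A [B [h <-]]] := fold_onth2 e g.
  have [_ op] := fold_bd w; rewrite h in op.
  exact: (triangle' V op).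
Qed.

Lemma icls_mrg j i l (t s : cell2 (inflate X)) (m : mergeable j i l (outp t) (inp s)) :
  mrg j i l t s = @icls X (tmrg j i l (irepr t) (irepr s))
                       (And3 (irepr_wf t) (irepr_wf s) m).
Proof.
rewrite -[X in @mrg _ _ _ _ X _](ireprK (irepr_wf t)).
by rewrite -[X in @mrg _ _ _ _ _ X](ireprK (irepr_wf s)); apply: imrg_cls.
Qed.

Lemma fold_icls t (w : twf t) : fold_term (irepr (icls w)) = fold_term t.
Proof. exact: fold_cong (irepr_cong w) (irepr_wf _). Qed.

Lemma fold_is_morphism : @is_morphism (inflate X) Z (mor0 f) fold1
  (fun p => fold_term (irepr p)).
Proof.
split=> [a|a|p|p|j i l t s m].
- exact: (fold1_endpt true).
- exact: (fold1_endpt false).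
- by have [] := fold_bd (irepr_wf p).
- by have [] := fold_bd (irepr_wf p).
by rewrite icls_mrg fold_icls.
Qed.

Definition fold : morphism (inflate X) Z := Morphism fold_is_morphism.

Lemma fold_unitors : unitors_mor (inflate_unitors X) V fold.
Proof.
split=> //= [a|s a|s a]; first exact: fold_icls.
  by case: s; apply: fold_icls.
by case: s; apply: fold_icls.
Qed.

Lemma fold_eta : comp_mor fold (eta X) = f.
Proof. by apply: morphism_ext => //= p; apply: fold_icls. Qed.

(** A 2-cell of the inflation is a merge of generators, on which g and h agree. *)
Lemma inflate_mor_ext (g h : morphism (inflate X) Z) :
  unitors_mor (inflate_unitors X) V g -> unitors_mor (inflate_unitors X) V h ->
  comp_mor g (eta X) = comp_mor h (eta X) -> g = h.
Proof.
move=> ug uh e.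
have e0 : mor0 g =1 mor0 h by move=> x; have /(congr1 (@mor0 _ _)) /(congr1 (@^~ x)) := e.
have e1 : mor1 g =1 mor1 h.
  case=> [a|x]; first by have /(congr1 (@mor1 _ _)) /(congr1 (@^~ a)) := e.
  by rewrite [LHS](um_cu ug) [RHS](um_cu uh) e0.
have e2 p : mor2 g (mor2 (eta X) p) = mor2 h (mor2 (eta X) p).
  by have /(congr1 (@mor2 _ _)) /(congr1 (@^~ p)) := e.
apply: morphism_ext => // p.
rewrite -[p](ireprK (irepr_wf p)); move: (irepr p) (irepr_wf p) => {p}.
have ieq (t : iterm X) (w w' : twf t) : icls w = icls w' by rewrite (Prop_irrelevance w w').
elim=> [p w|a w|a w|a w|a w|a w|j i l t IHt s IHs w].
- by rewrite (ieq _ w I); apply: e2.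
- by rewrite (ieq _ w I) [LHS](um_eps ug) [RHS](um_eps uh) e1.
- by rewrite (ieq _ w I) [LHS](um_lam ug true) [RHS](um_lam uh true) e1.
- by rewrite (ieq _ w I) [LHS](um_lam' ug true) [RHS](um_lam' uh true) e1.
- by rewrite (ieq _ w I) [LHS](um_lam ug false) [RHS](um_lam uh false) e1.
- by rewrite (ieq _ w I) [LHS](um_lam' ug false) [RHS](um_lam' uh false) e1.
have [wt ws m] := w.
have m' : mergeable j i l (ioutp (icls wt)) (iinp (icls ws)).
  by rewrite iinp_cls ioutp_cls.
rewrite -(imrg_cls wt ws w) [LHS](mor_mrg (moraxioms g) m').
by rewrite [RHS](mor_mrg (moraxioms h) m') IHt IHs.
Qed.

End Fold.

Lemma unitors_mor_comp (X Y Z : mergeBicat) (U : unitors X) (V : unitors Y)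
  (W : unitors Z) (g : morphism Y Z) (f : morphism X Y) :
  unitors_mor V W g -> unitors_mor U V f -> unitors_mor U W (comp_mor g f).
Proof.
move=> [g1 g2 g3 g4] [f1 f2 f3 f4].
by split=> /= *; rewrite ?f1 ?f2 ?f3 ?f4 ?g1 ?g2 ?g3 ?g4.
Qed.

(** So the functorial action and the multiplication of the monad preserve
    unitors. *)
Lemma extension_fold (X Z : mergeBicat) (f : morphism X (inflate Z)) :
  extension f = fold (inflate_unitors Z) f.
Proof. by apply: morphism_ext. Qed.

(** Associativity compares two unitor-preserving morphisms out of a double inflation,
    both of which restrict to alpha. *)
Lemma fold_algebra (X : mergeBicat) (V : unitors X) :
  is_algebra (fold V (id_mor X)).
Proof.
set alpha := fold _ _.
split; first exact: fold_eta.
have ua : unitors_mor (inflate_unitors X) V alpha := fold_unitors _ _.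
have ui (g : morphism (inflate X) X) :
    unitors_mor (inflate_unitors (inflate X)) (inflate_unitors X) (inflate_mor g).
  by rewrite /inflate_mor extension_fold; apply: fold_unitors.
have um : unitors_mor (inflate_unitors (inflate X)) (inflate_unitors X) (mu X).
  by rewrite /mu extension_fold; apply: fold_unitors.
apply: (inflate_mor_ext (V := V)).
- exact: unitors_mor_comp ua (ui alpha).
- exact: unitors_mor_comp ua um.
have compA (A B C D : mergeBicat) (h : morphism C D) (g : morphism B C) (k : morphism A B) :
    comp_mor (comp_mor h g) k = comp_mor h (comp_mor g k) by apply: morphism_ext.
rewrite !compA /inflate_mor /mu !extension_fold !fold_eta -compA fold_eta.
exact: morphism_ext.
Qed.

(** * From algebras to unitors *)

Lemma mergeable_outE (T : Type) (A : seq T) a B :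
  mergeable (size A) 0 1 (A ++ a :: B) [:: a].
Proof. by apply: mergeable_out; rewrite onth_size_cat. Qed.

Lemma mergeable_inE (T : Type) (A : seq T) a B :
  mergeable 0 (size A) 1 [:: a] (A ++ a :: B).
Proof. by apply: mergeable_in; rewrite onth_size_cat. Qed.

Lemma mor_endpt (Z W : mergeBicat) (h : morphism Z W) s a :
  endpt s (mor1 h a) = mor0 h (endpt s a).
Proof. by case: s; [apply: mor_src (moraxioms h) _|apply: mor_tgt (moraxioms h) _]. Qed.

Lemma inp_mor_cat (Z W : mergeBicat) (h : morphism Z W) (p : cell2 Z) A a B :
  inp p = A ++ a :: B -> inp (mor2 h p) = map (mor1 h) A ++ mor1 h a :: map (mor1 h) B.
Proof. by move=> e; rewrite (mor_inp (moraxioms h)) e map_cat. Qed.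

Lemma outp_mor_cat (Z W : mergeBicat) (h : morphism Z W) (p : cell2 Z) A a B :
  outp p = A ++ a :: B -> outp (mor2 h p) = map (mor1 h) A ++ mor1 h a :: map (mor1 h) B.
Proof. by move=> e; rewrite (mor_outp (moraxioms h)) e map_cat. Qed.

Section RetractUnitors.
Variables (Y X : mergeBicat) (U : unitors Y) (f : morphism Y X) (g : morphism X Y).
Hypothesis fg : comp_mor f g = id_mor X.
Hypothesis f_lam : forall s a,
  mor2 f (lam U s (mor1 g (mor1 f a))) = mor2 f (lam U s a).
Hypothesis f_lam' : forall s a,
  mor2 f (lam' U s (mor1 g (mor1 f a))) = mor2 f (lam' U s a).

Lemma retract0 x : mor0 f (mor0 g x) = x.
Proof. by have /(congr1 (@mor0 _ _)) /(congr1 (@^~ x)) := fg. Qed.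

Lemma retract1 a : mor1 f (mor1 g a) = a.
Proof. by have /(congr1 (@mor1 _ _)) /(congr1 (@^~ a)) := fg. Qed.

Lemma retract2 p : mor2 f (mor2 g p) = p.
Proof. by have /(congr1 (@mor2 _ _)) /(congr1 (@^~ p)) := fg. Qed.

Lemma retract_merge j i l (t s : cell2 Y) (t' s' : cell2 X) :
  mergeable j i l (outp t) (inp s) -> mor2 f t = t' -> mor2 f s = s' ->
  mrg j i l t' s' = mor2 f (mrg j i l t s).
Proof. by move=> m <- <-; rewrite (mor_mrg (moraxioms f) m). Qed.

(** Each law for a 2-cell p of X is the image of the law for g p.  In the laws that
    relate the unitors of a 1-cell [cu x] of X, the retract introduces
    g (f (cu y)) in place of the 1-cell cu y of Y; this is where [f_lam] and
    [f_lam'] enter. *)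
Definition retract_unitors : unitors X.
Proof.
refine (@Unitors X (fun x => mor1 f (cu U (mor0 g x)))
  (fun a => mor2 f (eps U (mor1 g a))) (fun s a => mor2 f (lam U s (mor1 g a)))
  (fun s a => mor2 f (lam' U s (mor1 g a))) _ _ _ _ _ _ _ _ _ _ _).
- by move=> s x; rewrite mor_endpt cu_endpt retract0.
- move=> a; have u := eps_unit U (mor1 g a); have [u1 u2 _ _] := u.
  apply: unitI => [||A B p e|A B p e].
  + by rewrite (mor_inp (moraxioms f)) u1 /= retract1.
  + by rewrite (mor_outp (moraxioms f)) u2 /= retract1.
  + have op := outp_mor_cat g e; rewrite -[RHS]retract2.
    rewrite -(unit_out u _ op erefl erefl) //.
    rewrite -(retract_merge (t' := p) _ _ erefl) ?retract2 ?size_map //.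
    by rewrite op u1 -(size_map (mor1 g) A); apply: mergeable_outE.
  + have ip := inp_mor_cat g e; rewrite -[RHS]retract2.
    rewrite -(unit_in u _ ip erefl erefl) //.
    rewrite -(retract_merge (s' := p) _ erefl) ?retract2 ?size_map //.
    by rewrite ip u2 -(size_map (mor1 g) A); apply: mergeable_inE.
- move=> s a; have [h k] := lam_bd U s (mor1 g a).
  rewrite (mor_inp (moraxioms f)) (mor_outp (moraxioms f)) h k pad_map /=.
  by rewrite mor_endpt retract1.
- move=> s a; have [h k] := lam'_bd U s (mor1 g a).
  rewrite (mor_inp (moraxioms f)) (mor_outp (moraxioms f)) h k pad_map /=.
  by rewrite mor_endpt retract1.
- by move=> x; rewrite !f_lam lam_cu.
- by move=> x; rewrite !f_lam' lam'_cu.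
- move=> s a; rewrite -(lam'K U s) -(retract_merge _ erefl erefl) //.
  have [_ ->] := lam'_bd U s (mor1 g a); have [-> _] := lam_bd U s (mor1 g a).
  by case: (s); apply: mergeable_all.
- move=> s p A a B C b D /(inp_mor_cat g) ip /(outp_mor_cat g) op.
  move=> /(extremal_map (mor1 g)) eA /(extremal_map (mor1 g)) eC.
  have := congr1 (mor2 f) (lam_nat U ip op eA eC).
  rewrite -(retract_merge (t' := p) _ _ erefl) ?retract2 ?size_map //; last first.
    rewrite op; have [-> _] := lam_bd U s (mor1 g b).
    by rewrite -(size_map (mor1 g) C); apply: mergeable_padl.
  rewrite -(retract_merge (s' := p) _ erefl) ?retract2 ?size_map //.
  rewrite ip; have [_ ->] := lam_bd U s (mor1 g a).
  by rewrite -(size_map (mor1 g) A); apply: mergeable_inE.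
- move=> s p A a B C b D /(inp_mor_cat g) ip /(outp_mor_cat g) op.
  move=> /(extremal_map (mor1 g)) eA /(extremal_map (mor1 g)) eC.
  have := congr1 (mor2 f) (lam'_nat U ip op eA eC).
  rewrite -(retract_merge (t' := p) _ _ erefl) ?retract2 ?size_map //; last first.
    rewrite op; have [-> _] := lam'_bd U s (mor1 g b).
    by rewrite -(size_map (mor1 g) C); apply: mergeable_outE.
  rewrite -(retract_merge (s' := p) _ erefl) ?retract2 ?size_map //.
  rewrite ip; have [_ ->] := lam'_bd U s (mor1 g a).
  by rewrite -(size_map (mor1 g) A); apply/mergeable_sym/mergeable_padl.
- move=> p A a b B ip.
  have ia := inp_mor_cat g ip; have ib : inp p = (rcons A a) ++ b :: B.
    by rewrite cat_rcons.
  have {}ib := inp_mor_cat g ib.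
  have := congr1 (mor2 f) (triangle U ia).
  rewrite -(retract_merge (s' := p) _ erefl) ?retract2 ?size_map //; last first.
    rewrite ia; have [_ ->] := lam_bd U false (mor1 g a).
    by rewrite -(size_map (mor1 g) A); apply: mergeable_inE.
  rewrite -(retract_merge (s' := p) _ erefl) ?retract2 ?size_map //.
  rewrite ib; have [_ ->] := lam_bd U true (mor1 g b).
  by rewrite -(size_rcons A a) -(size_map (mor1 g) (rcons A a)); apply: mergeable_inE.
- move=> p A a b B ip.
  have ia := outp_mor_cat g ip; have ib : outp p = (rcons A a) ++ b :: B.
    by rewrite cat_rcons.
  have {}ib := outp_mor_cat g ib.
  have := congr1 (mor2 f) (triangle' U ia).
  rewrite -(retract_merge (t' := p) _ _ erefl) ?retract2 ?size_map //; last first.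
    rewrite ia; have [-> _] := lam'_bd U false (mor1 g a).
    by rewrite -(size_map (mor1 g) A); apply: mergeable_outE.
  rewrite -(retract_merge (t' := p) _ _ erefl) ?retract2 ?size_map //.
  rewrite ib; have [-> _] := lam'_bd U true (mor1 g b).
  by rewrite -(size_rcons A a) -(size_map (mor1 g) (rcons A a)); apply: mergeable_outE.
Defined.

End RetractUnitors.

(** The associativity law, evaluated at the unitors added by the second inflation,
    says that alpha cannot tell the unitors of a 1-cell from those of its image. *)
Lemma algebra_unitors (X : mergeBicat) (alpha : morphism (inflate X) X) :
  is_algebra alpha -> inhabited (unitors X).
Proof.
case=> fg assoc.
have um (f : morphism X (inflate X)) :
    unitors_mor (inflate_unitors X) (inflate_unitors X) (extension f).
  by rewrite extension_fold; apply: fold_unitors.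
have ui : unitors_mor (inflate_unitors (inflate X)) (inflate_unitors X) (inflate_mor alpha).
  by rewrite /inflate_mor extension_fold; apply: fold_unitors.
have uu : unitors_mor (inflate_unitors (inflate X)) (inflate_unitors X) (mu X).
  by rewrite /mu extension_fold; apply: fold_unitors.
have E c : mor2 alpha (mor2 (inflate_mor alpha) c) = mor2 alpha (mor2 (mu X) c).
  by have /(congr1 (@mor2 _ _)) /(congr1 (@^~ c)) := assoc.
constructor; apply: (retract_unitors (U := inflate_unitors X) fg).
- move=> s a.
  have := E (lam (inflate_unitors (inflate X)) s (iold (X := inflate X) a)).
  by rewrite (um_lam ui) (um_lam uu).
move=> s a.
have := E (lam' (inflate_unitors (inflate X)) s (iold (X := inflate X) a)).
by rewrite (um_lam' ui) (um_lam' uu).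
Qed.

(** * Strength of the extension *)

Section Cancel.
Variables (X : mergeBicat) (V : unitors X).
Implicit Types (s : bool) (p q r t w : cell2 X) (a b c e : cell1 X)
  (A B C D : seq (cell1 X)).

(** The 2-cells p and t feed the two inputs of w; which of them stands on the left
    depends on s, whence the positions n and m. *)
Lemma pad_swap s e b w p t C D n m : inp w = pad s e b ->
  outp p = C ++ b :: D -> outp t = [:: e] -> extremal s C D ->
  n = (if s then size (inp t) else 0) ->
  m = (if s then 0 else size (inp p)) ->
  mrg (size C) n 1 p (mrg 0 (~~ s) 1 t w) = mrg 0 m 1 t (mrg (size C) s 1 p w).
Proof.
case: s => /= iw op ot ext -> ->; rewrite ext in op *.
  by apply/esym; apply: (@mrg_swap X [::] [:: e] [:: b] D [::] [::] [::]);
    rewrite //= ?cats0.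
by apply: (@mrg_swap X C [:: b] [:: e] [::] [::] [::] [::]); rewrite //= ?cats0.
Qed.

Lemma lam_out_inj s a A B r r' : extremal s A B -> inp r = inp r' ->
  outp r = A ++ a :: B -> outp r' = A ++ a :: B ->
  mrg (size A) s 1 r (lam V s a) = mrg (size A) s 1 r' (lam V s a) -> r = r'.
Proof.
move=> ext ii or or'.
have [D1 [d [D2 [eD extD]]]] := extremal_split s (@inp_neq0 _ (maxioms X) r).
have eD' := eD; rewrite ii in eD'.
rewrite (lam_nat V eD or extD ext) (lam_nat V eD' or' extD ext).
exact: (inverse_in_inj (lam_inverse V s d) eD eD').
Qed.

(** Here psi exhibits u' as an inverse of e.  Merging r ; t with the inverse of t
    whiskers r with e, and merging further with psi ; lam, which has inputs u', e
    and a, gives psi ; (r ; lam).  Both psi and lam can then be cancelled. *)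
Lemma invertible_cancel s e u' a c psi psi' t t' A B r r' :
  inverse (pad (~~ s) e u') [:: cu V (endpt (~~ s) e)] psi psi' ->
  inverse (pad s e a) [:: c] t t' ->
  extremal s A B -> inp r = inp r' ->
  outp r = A ++ a :: B -> outp r' = A ++ a :: B ->
  mrg (size A) s 1 r t = mrg (size A) s 1 r' t -> r = r'.
Proof.
move=> hpsi ht ext ii or or' E1.
have [[t1 t2] [t3 t4] hi _] := ht; have [[f1 f2] _ _ _] := hpsi.
set i := mrg _ _ _ t t' in hi; have [i1 i2 _ _] := hi.
have ea : endpt (~~ s) e = endpt s a.
  by apply: (@path_pad X t s e a [::] [::]); rewrite cats0.
rewrite ea in f2 hpsi.
have [l1 l2] := lam_bd V s a; set x := endpt s a in l1 f2 hpsi.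
pose th := mrg 0 (~~ s) 1 psi (lam V s a).
have th1 : inp th = padl s u' ++ pad s e a ++ padr s u'.
  have [] := @mrg_bd X [::] [:: cu V x] [::] (padl (~~ s) a) (padr (~~ s) a) 0 (~~ s) 1
    psi (lam V s a); rewrite ?size_padl ?l1 -?pad_split ?f1 //.
  by move=> -> _; case: (s).
have with_i q : outp q = A ++ a :: B ->
    mrg (size A) s 1 q i = mrg (size A) 0 1 (mrg (size A) s 1 q t) t'.
  move=> oq; apply/esym; apply: (@mrg_assoc X A [::] [:: a] [::] B (padl s e) (padr s e)
    [::] [:: c] [::] [::] [::]); rewrite ?cats0 //; try by sizes.
  - exact: extremal_l ext.
  - exact: extremal_r ext.
have with_th q : outp q = A ++ a :: B ->
    mrg (size A) (s + s) 1 q th = mrg (size A) s 2 (mrg (size A) s 1 q i) th.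
  move=> oq; have P0 := @pad_neq0 _ s e a.
  rewrite -{1}(unit_in hi P0 th1 erefl erefl) size_pad size_padl.
  apply/esym; apply: (@mrg_assoc X A [::] [:: a] [::] B (padl s e) (padr s e)
    [::] (pad s e a) [::] (padl s u') (padr s u')); rewrite ?cats0 //; try by sizes.
  - exact: extremal_l ext.
  - exact: extremal_r ext.
  - exact: extremal_l ext.
  - exact: extremal_r ext.
have E2 : mrg (size A) (s + s) 1 r th = mrg (size A) (s + s) 1 r' th.
  by rewrite !with_th // !with_i // E1.
have swap q : outp q = A ++ a :: B -> mrg (size A) (s + s) 1 q th =
    mrg 0 (if s then 0 else size (inp q)) 1 psi (mrg (size A) s 1 q (lam V s a)).
  move=> oq; apply: (pad_swap l1 oq f2 ext) => //.
  by rewrite f1 size_pad; case: (s).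
rewrite !swap // -ii in E2.
have bd q : outp q = A ++ a :: B -> inp q = inp r ->
    inp (mrg (size A) s 1 q (lam V s a)) =
      (if s then [::] else inp r) ++ [:: cu V x] ++ (if s then inp r else [::]).
  move=> oq iq.
  have [] := @mrg_bd X A [:: a] B (padl s (cu V x)) (padr s (cu V x)) (size A) s 1
    q (lam V s a); rewrite ?size_padl ?iq //.
  - exact: extremal_l ext.
  - exact: extremal_r ext.
  - by move=> -> _; case: (s); rewrite /= ?cats0.
apply: (lam_out_inj ext ii or or').
apply: (inverse_in_inj hpsi (bd r or erefl) (bd r' or' (esym ii)) _ _ E2) => //.
by case: (s).
Qed.

End Cancel.

Lemma unital_inverse (X : mergeBicat) (t : cell2 X) c : unital X ->
  outp t = [:: c] -> out_universal t 0 -> exists t', inverse (inp t) [:: c] t t'.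
Proof.
move=> un ot ht; have i0 := @inp_neq0 _ (maxioms X) t.
have [x [y [h k]]] := parallel (maxioms X) t.
have [|u hu] := un _ i0; first by exists x, y.
have [|u' hu'] := un [:: c] ltac:(done); first by exists (src c), (tgt c).
exact: out_universal_inverse hu hu' ht.
Qed.

Section Strong.
Variables (Y X : mergeBicat) (U : unitors Y) (V : unitors X).
Variables (f : morphism Y X) (g : morphism X Y).
Hypothesis fU : unitors_mor U V f.
Hypothesis fg : comp_mor f g = id_mor X.
Hypothesis cover : forall e : cell1 Y,
  (exists e0, e = mor1 g e0) \/ (exists y, e = cu U y).

Let fg1 : forall a, mor1 f (mor1 g a) = a := retract1 fg.
Let fg2 : forall p, mor2 f (mor2 g p) = p := retract2 fg.

Lemma map_fg A : map (mor1 f) (map (mor1 g) A) = A.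
Proof. by rewrite -map_comp -[RHS]map_id; apply: eq_map. Qed.

Lemma mor_unit1 a u : is_unit [:: a] u -> is_unit [:: mor1 f a] (mor2 f u).
Proof.
move=> hu; rewrite (unit_uniq _ hu (eps_unit U a)) // (um_eps fU).
exact: eps_unit.
Qed.

(** Units on pairs are preserved because they are merges of unitors. *)
Lemma mor_unit2 a b u : is_unit [:: a; b] u ->
  is_unit [:: mor1 f a; mor1 f b] (mor2 f u).
Proof.
move=> hu; have [u1 _ _ _] := hu.
have ab : tgt a = src b := @path_pair Y u [::] a b [::] u1.
have -> : u = pair_id U a b by exact: unit_uniq hu (pair_id_unit U ab).
have [_ l1] := lam'_bd U false a; have [l2 _] := lam_bd U true b.
rewrite /pair_id (mor_mrg (moraxioms f)) ?(um_lam fU) ?(um_lam' fU); last first.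
  by rewrite l1 l2 /= ab; apply: mergeable_ls.
apply: pair_id_unit.
by rewrite (mor_tgt (moraxioms f)) (mor_src (moraxioms f)) ab.
Qed.

Lemma mor_inverse s e a c t t' : inverse (pad s e a) [:: c] t t' ->
  inverse (pad s (mor1 f e) (mor1 f a)) [:: mor1 f c] (mor2 f t) (mor2 f t').
Proof.
case=> -[t1 t2] [t3 t4] h k.
rewrite /inverse !(mor_inp (moraxioms f)) !(mor_outp (moraxioms f)) t1 t2 t3 t4.
rewrite pad_map !size_pad; rewrite size_pad in k; split=> //.
  rewrite -(mor_mrg (moraxioms f)); last by rewrite t2 t3; apply: (@mergeable_inE _ [::]).
  by case: (s) h => h; apply: mor_unit2.
rewrite -(mor_mrg (moraxioms f)); last by rewrite t4 t1; case: (s); apply: mergeable_all.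
exact: mor_unit1.
Qed.

Lemma mor_tensor t : is_tensor t -> is_tensor (mor2 f t).
Proof.
case=> a [b [c [t1 t2 t3]]]; exists (mor1 f a), (mor1 f b), (mor1 f c).
rewrite (mor_inp (moraxioms f)) (mor_outp (moraxioms f)) t1 t2; split=> //.
have [t' v] := unital_inverse (unitors_unital U) t2 t3; rewrite t1 in v.
exact: inverse_out_universal (mor_inverse (s := true) v).
Qed.

(** Existence of factors is inherited from Y, uniqueness comes from
    [invertible_cancel].  Only one of u and c is asked to lie in the image of g,
    as the definition of a tensor universal 1-cell prescribes only one of them. *)
Lemma mor_side_universal s e0 u c u' :
  side_universal (~~ s) (mor1 g e0) u' (cu U (endpt (~~ s) (mor1 g e0))) ->
  side_universal s (mor1 g e0) u c ->
  (exists u0, u = mor1 g u0) \/ (exists c0, c = mor1 g c0) ->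
  side_universal s e0 (mor1 f u) (mor1 f c).
Proof.
case=> psi [p1 p2 /(unital_inverse (unitors_unital U) p2) [psi' vpsi] _].
case=> t [t1 t2 t3 /(in_universalP t1 t2) t4] lift.
have [t' v] := unital_inverse (unitors_unital U) t2 t3.
rewrite p1 in vpsi; rewrite t1 in v.
have w := mor_inverse v; have wpsi := mor_inverse vpsi.
rewrite fg1 in w wpsi; rewrite (um_cu fU) mor_endpt (retract0 fg) in wpsi.
have [[w1 w2] [w3 w4] _ _] := w.
exists (mor2 f t); split=> //; first exact: inverse_out_universal w.
apply/(in_universalP w1 w2) => A B D q D0 ext iq oq.
have extg := extremal_map (mor1 g) ext.
(* A 2-cell of Y over q that can be factored through t.  If c comes from X it is
   the image of q; if u does, it is the image of q ; t' merged with t. *)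
have [qh [h1 h2 h3]] : exists qh : cell2 Y,
    [/\ inp qh = padl s (mor1 g e0) ++ map (mor1 g) D ++ padr s (mor1 g e0),
        outp qh = map (mor1 g) A ++ c :: map (mor1 g) B & mor2 f qh = q].
  have gpad : inp (mor2 g q) =
      padl s (mor1 g e0) ++ map (mor1 g) D ++ padr s (mor1 g e0).
    by rewrite (mor_inp (moraxioms g)) iq !map_cat padl_map padr_map.
  case: lift => -[b0 eb]; subst; last first.
    exists (mor2 g q); rewrite fg2; split=> //.
    by rewrite (mor_outp (moraxioms g)) oq map_cat /= fg1.
  have [k1 k2] : inp (mrg (size A) 0 1 q (mor2 f t')) = inp q /\
      outp (mrg (size A) 0 1 q (mor2 f t')) = A ++ pad s e0 b0 ++ B.
    have [] := @mrg_bd X A [:: mor1 f c] B [::] [::] (size A) 0 1 q (mor2 f t');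
      by rewrite // w4 fg1 cats0.
  pose q1 := mor2 g (mrg (size A) 0 1 q (mor2 f t')).
  have j1 : inp q1 = padl s (mor1 g e0) ++ map (mor1 g) D ++ padr s (mor1 g e0).
    by rewrite (mor_inp (moraxioms g)) k1 -(mor_inp (moraxioms g)).
  have j2 : outp q1 = map (mor1 g) A ++ pad s (mor1 g e0) (mor1 g b0) ++ map (mor1 g) B.
    by rewrite (mor_outp (moraxioms g)) k2 map_cat (map_cat _ (pad _ _ _)) pad_map.
  have P0 := @pad_neq0 _ s (mor1 g e0) (mor1 g b0).
  have m : mergeable (size A) 0 2 (outp q1) (inp t).
    by apply: (@glue_mergeable Y (map (mor1 g) A) (pad s (mor1 g e0) (mor1 g b0))
      (map (mor1 g) B) [::] [::]); rewrite ?size_map ?size_pad ?cats0.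
  have [b1 b2] : inp (mrg (size A) 0 2 q1 t) = inp q1 /\
      outp (mrg (size A) 0 2 q1 t) = map (mor1 g) A ++ c :: map (mor1 g) B.
    by have [] := @mrg_bd Y (map (mor1 g) A) (pad s (mor1 g e0) (mor1 g b0))
      (map (mor1 g) B) [::] [::] (size A) 0 2 q1 t;
      rewrite ?size_map ?size_pad ?cats0 // ?t2.
  exists (mrg (size A) 0 2 q1 t); rewrite b1; split=> //.
  rewrite (mor_mrg (moraxioms f)) // /q1 fg2.
  by apply: (inverse_outK (inverse_sym w) oq); rewrite ?size_pad.
have D0' : map (mor1 g) D <> [::] by case: (D) D0.
have [rh [[r1 r2 r3] _]] := t4 _ _ _ qh D0' extg h1 h2.
have m : mergeable (size A) s 1 (outp rh) (inp t).
  by rewrite r2 t1 -(size_map (mor1 g) A); apply: mergeable_padl.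
have s1 : inp (mor2 f rh) = D by rewrite (mor_inp (moraxioms f)) r1 map_fg.
have s2 : outp (mor2 f rh) = A ++ mor1 f u :: B.
  by rewrite (outp_mor_cat f r2) !map_fg.
have s3 : mrg (size A) s 1 (mor2 f rh) (mor2 f t) = q.
  by rewrite -(mor_mrg (moraxioms f)) // -h3 -r3 size_map.
exists (mor2 f rh); split=> // r' [q1 q2 q3].
apply: (invertible_cancel wpsi w ext _ s2 q2); first by rewrite s1 q1.
by rewrite s3 q3.
Qed.

Lemma mor_tensor_universal e : tensor_universal e -> tensor_universal (mor1 f e).
Proof.
case: (cover e) => [[e0 ->]|[y ->] _]; last first.
  rewrite (um_cu fU); apply: tensor_unit_universal; exact: cu_tensor_unit.
case/tensor_universalP=> h k; rewrite fg1.
(* The inverse of e0 on side s: a solution u' of the condition for the unit. *)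
have psi s : exists u', side_universal (~~ s) (mor1 g e0) u'
    (cu U (endpt (~~ s) (mor1 g e0))).
  by apply: h; rewrite cu_endpt.
apply/tensor_universalP; split=> s a ea.
  have [u' hpsi] := psi s; have [|u hu] := h s (mor1 g a).
    by rewrite !mor_endpt ea.
  exists (mor1 f u); rewrite -[a]fg1; apply: mor_side_universal hpsi hu _.
  by right; exists a.
have [u' hpsi] := psi s; have [|v hv] := k s (mor1 g a).
  by rewrite !mor_endpt ea.
exists (mor1 f v); rewrite -[a]fg1; apply: mor_side_universal hpsi hv _.
by left; exists a.
Qed.

End Strong.

Lemma op_morphism (Y X : mergeBicat) (f : morphism Y X) :
  @is_morphism (op_mergeBicat Y) (op_mergeBicat X) (mor0 f) (mor1 f) (mor2 f).
Proof.
case: f => f0 f1 f2 [h1 h2 h3 h4 h5]; split=> //= j i l t s m.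
exact/h5/mergeable_sym.
Qed.

Lemma fold_strong (X : mergeBicat) (V : unitors X) : strong (fold V (id_mor X)).
Proof.
set f := fold _ _.
have fU : unitors_mor (inflate_unitors X) V f := fold_unitors _ _.
have fg : comp_mor f (eta X) = id_mor X := fold_eta _ _.
have cover (e : icell1 X) : (exists e0, e = iold e0) \/ (exists x, e = iunit x).
  by case: e => a; [left|right]; exists a.
pose f' : morphism (op_mergeBicat (inflate X)) (op_mergeBicat X) :=
  Morphism (op_morphism f).
pose g' : morphism (op_mergeBicat X) (op_mergeBicat (inflate X)) :=
  Morphism (op_morphism (eta X)).
have fU' : unitors_mor (op_unitors (inflate_unitors X)) (op_unitors V) f'.
  by split; [apply: um_cu fU|apply: um_eps fU|apply: um_lam' fU|apply: um_lam fU].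
have fg' : comp_mor f' g' = id_mor (op_mergeBicat X).
  by apply: morphism_ext => //= p; apply: (retract2 fg).
split.
- exact: mor_unit1 fU.
- exact (mor_tensor_universal fU fg cover).
- exact (mor_tensor_universal fU' fg' cover).
- exact (mor_tensor fU).
- exact (mor_tensor fU').
Qed.

Theorem proposition6p6 (X : mergeBicat) :
  (exists alpha : morphism (inflate X) X, is_algebra alpha /\ strong alpha)
  <-> zero_representable X.
Proof.
split=> [[alpha [/algebra_unitors [V] _]]|/representable_unitors [V]].
  exact: unitors_representable V.
exists (fold V (id_mor X)); split; first exact: fold_algebra.
exact: fold_strong.
Qed.
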